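(* Let $\mathcal{C}$ be any one of the following classes of binary relations: directed graphs (irreflexive relations); graphs (irreflexive and symmetric relations); oriented graphs (irreflexive and antisymmetric relations); quasi-orders (reflexive and transitive relations); strict quasi-orders (irreflexive and transitive relations); partial orders (reflexive, antisymmetric and transitive relations); strict partial orders (irreflexive, antisymmetric and transitive relations). Then there is a family $(R_\alpha)_{\alpha\in 2^\omega}$ of relations on $2^\omega\times 2$, each belonging to $\mathcal{C}$ and each a difference of two open subsets of $(2^\omega\times 2)^2$, which is a perfect $\leq_B$-antichain, and such that for every $\alpha\in 2^\omega$ the relation $R_\alpha$ is $\leq_B$-minimal among Borel relations that are not potentially closed: $R_\alpha$ is not potentially closed, and whenever $X$ is a Polish space and $R\subseteq X^2$ is a Borel relation which is not potentially closed with $R\leq_B R_\alpha$, then $R_\alpha\leq_B R$.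
   Context: Here $2$ is the discrete space $\{0,1\}$. A Borel set $A\subseteq X\times Y$ ($X,Y$ Polish) is potentially closed if there are Polish topologies on $X$ and on $Y$, finer than the original ones, making $A$ closed in the product. For $E\subseteq X^2$, $E'\subseteq X'^2$ ($X,X'$ Polish), $E\leq_B E'$ means there is a Borel map $u:X\to X'$ with $E=(u\times u)^{-1}(E')$. A family $(R_\alpha)_{\alpha\in 2^\omega}$ of Borel sets is a perfect antichain for a quasi-order $\leq$ if $R_\alpha\not\leq R_{\alpha'}$ whenever $\alpha\neq\alpha'$, and there is a continuous $c:2^\omega\to 2^\omega$ such that $c(\alpha)$ is a Borel code for $R_\alpha$ for each $\alpha$. *)

(* Defs.v *)
From HB Require Import structures.
From mathcomp Require Import all_boot all_order all_algebra.
From mathcomp Require Import all_classical all_reals all_analysis.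

Set Implicit Arguments.
Unset Strict Implicit.
Unset Printing Implicit Defensive.

Local Open Scope classical_set_scope.

(* The metric is quantified as a [Metric] structure on the carrier of [T] which
   induces the given topology. No point of [T] is required: the empty space is
   Polish. *)
Definition polish (K : realType) (T : topologicalType) : Prop :=
  exists m : Metric.axioms_ K T,
    let M : metricType K := Metric.Pack m in
    [/\ forall U : set T, @open M U <-> open U,
        forall u : nat -> M, cauchy (u @ \oo) -> exists l : M, u @ \oo --> l
      & exists2 D : set T, countable D & dense D].

Definition finer (X : topologicalType) (t : Topological.axioms_ X) : Prop :=
  forall U : set X, open U -> @open (Topological.Pack t) U.

Definition potentially_closed (K : realType) (X Y : topologicalType)
    (A : set (X * Y)) : Prop :=
  exists (tX : Topological.axioms_ X) (tY : Topological.axioms_ Y),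
    let X' : topologicalType := Topological.Pack tX in
    let Y' : topologicalType := Topological.Pack tY in
    [/\ polish K X' /\ finer tX,
        polish K Y' /\ finer tY
      & @closed (X' * Y')%type A].

Definition borel (T : topologicalType) : set (set T) := <<s @open T >>.

Definition borel_map (X Y : topologicalType) (u : X -> Y) : Prop :=
  forall B : set Y, borel B -> borel (u @^-1` B).

Definition borel_reducible (X X' : topologicalType)
    (E : set (X * X)) (E' : set (X' * X')) : Prop :=
  exists2 u : X -> X', borel_map u &
    E = (fun p : X * X => (u p.1, u p.2)) @^-1` E'.

Definition minimal_not_potentially_closed (K : realType) (X0 : topologicalType)
    (E : set (X0 * X0)) : Prop :=
  ~ potentially_closed K E /\
  forall (X : topologicalType) (F : set (X * X)),
    polish K X -> borel F -> ~ potentially_closed K F ->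
    borel_reducible F E -> borel_reducible E F.

Section RelationClasses.
Variables (X : Type) (E : set (X * X)).

Definition reflexive_set : Prop := forall x, E (x, x).
Definition irreflexive_set : Prop := forall x, ~ E (x, x).
Definition symmetric_set : Prop := forall x y, E (x, y) -> E (y, x).
Definition antisymmetric_set : Prop :=
  forall x y, E (x, y) -> E (y, x) -> x = y.
Definition transitive_set : Prop :=
  forall x y z, E (x, y) -> E (y, z) -> E (x, z).

End RelationClasses.

Variant relation_class :=
  | DirectedGraph | Graph | OrientedGraph
  | QuasiOrder | StrictQuasiOrder | PartialOrder | StrictPartialOrder.

Definition in_class (C : relation_class) (X : Type) (E : set (X * X)) : Prop :=
  match C with
  | DirectedGraph => irreflexive_set E
  | Graph => irreflexive_set E /\ symmetric_set E
  | OrientedGraph => irreflexive_set E /\ antisymmetric_set E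
  | QuasiOrder => reflexive_set E /\ transitive_set E
  | StrictQuasiOrder => irreflexive_set E /\ transitive_set E
  | PartialOrder =>
      [/\ reflexive_set E, antisymmetric_set E & transitive_set E]
  | StrictPartialOrder =>
      [/\ irreflexive_set E, antisymmetric_set E & transitive_set E]
  end.

Definition difference_of_open (T : topologicalType) (A : set T) : Prop :=
  exists U V : set T, [/\ open U, open V & A = U `\` V].

Definition cantor2 : topologicalType := (cantor_space * bool)%type.

Definition cylinder (p : seq bool * bool) : set cantor2 :=
  [set x | (forall i, (i < size p.1)%N -> x.1 i = nth false p.1 i)
           /\ x.2 = p.2].

(* A recursive enumeration of the basis of [cantor2 * cantor2] formed by the
   products of two cylinders (and possibly the empty set). *)
Definition basic_open (n : nat) : set (cantor2 * cantor2) :=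
  if unpickle n is Some (p, q) then cylinder p `*` cylinder q else set0.

Definition code_section (c : cantor_space) (i : nat) : cantor_space :=
  fun n => c (pickle (i, n)).+1.

(* [borel_code c A]: the sequence [c] is a Borel code for [A]. The first bit
   tells whether the rest of [c] lists the basic open sets whose union is [A],
   or is a sequence of codes of sets whose union has complement [A]. *)
Inductive borel_code : cantor_space -> set (cantor2 * cantor2) -> Prop :=
  | code_open (c : cantor_space) :
      c 0%N = false ->
      borel_code c (\bigcup_(n in [set n | c n.+1 = true]) basic_open n)
  | code_setC_bigcup (c : cantor_space)
        (A : nat -> set (cantor2 * cantor2)) :
      c 0%N = true ->
      (forall i, borel_code (code_section c i) (A i)) ->
      borel_code c (~` \bigcup_i A i).

Definition perfect_antichain
    (le : set (cantor2 * cantor2) -> set (cantor2 * cantor2) -> Prop)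
    (R : cantor_space -> set (cantor2 * cantor2)) : Prop :=
  [/\ forall a, borel (R a),
      forall a b, a <> b -> ~ le (R a) (R b)
    & exists2 c : cantor_space -> cantor_space,
        continuous c & forall a, borel_code (c a) (R a)].

(* Main.v *)
(** Call two points of the Cantor space adjacent when they differ at exactly one
    coordinate [n], and direct the edge from the point whose [n]th bit is 0. Given
    [a], keep only the edges for which the number of ones before [n] lies in the set
    of positions of the ones in a Toeplitz word [levels a], and put such an edge
    between the copies 0 and 1 of its ends. This relation is closed apart from the
    pairs ((x,0),(x,1)), which are limits of it, and it is not potentially closed
    because by Baire category every countable Borel cover of the Cantor space has a
    member containing both ends of an allowed edge.

    For minimality, let [small] be the sigma-ideal generated by the Borel sets
    without adjacent points; it is invariant under flips, unlike its analogue for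
    the allowed edges. If F reduces to the relation through u, and the analytic set
    of the x such that both (x,0) and (x,1) are values of u is small, refining the
    topology makes F closed. Otherwise, by Lusin separation, flips of this analytic
    set meet it in a set which is not small, and iterating produces an embedding W of
    the Cantor space which carries the flip at i to the flip at some m i. The
    uniform recurrence of the Toeplitz word lets the shift in the number of ones be
    chosen so that allowed edges correspond to allowed edges.

    A Borel reduction between two of the relations is continuous on a comeager
    flip-invariant set, where it carries flips to flips; chains of commuting flips
    show that arbitrarily long windows of the two Toeplitz words coincide up to a
    reflection, and windows determine the parameter. *)
Require Import Defs.
From HB Require Import structures.
From mathcomp Require Import all_boot all_order all_algebra.
From mathcomp Require Import all_classical all_reals all_analysis.
From mathcomp Require Import zify.
Import IntDist.

Set Implicit Arguments.
Unset Strict Implicit.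
Unset Printing Implicit Defensive.

Local Open Scope classical_set_scope.

(** * Toeplitz words and flips *)

Definition flip (n : nat) (x : nat -> bool) : nat -> bool :=
  fun i => (i == n) (+) x i.
Arguments flip : simpl never.

Definition ones (x : nat -> bool) (n : nat) : nat := \sum_(i < n) x i.

Definition agree (T : Type) (k : nat) (x y : nat -> T) : Prop :=
  forall i, (i < k)%N -> x i = y i.

(** Each bit of [a] is followed by its negation, so both letters occur at arbitrarily large [v]
    whatever [a] is, and the even positions return [a]. *)
Definition toeplitz (a : nat -> bool) (v : nat) : bool := a v./2 (+) odd v.

(** A Toeplitz word: for [c > 0] the letter depends only on the 2-adic valuation of [c]. The hole at
    0 gets the letter true, so it can be matched at any position whose valuation carries true. *)
Definition levels (a : nat -> bool) (c : nat) : bool :=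
  (c == 0)%N || toeplitz a (logn 2 c).

Definition edge (a x y : nat -> bool) : Prop :=
  exists n, [/\ x n = false, y = flip n x & levels a (ones x n)].

Lemma flip_at n x : flip n x n = ~~ x n.
Proof. by rewrite /flip eqxx. Qed.

Lemma flip_neq n x i : i != n -> flip n x i = x i.
Proof. by rewrite /flip => /negbTE ->. Qed.

Lemma flipK n x : flip n (flip n x) = x.
Proof. by apply/funext => i; rewrite /flip addbA addbb. Qed.

Lemma flipC m n x : flip m (flip n x) = flip n (flip m x).
Proof. by apply/funext => i; rewrite /flip addbCA. Qed.

Lemma flip_neq_id n x : flip n x <> x.
Proof. by move/(congr1 (fun f => f n)); rewrite flip_at; case: (x n). Qed.

Lemma flip_inj_index m n x : flip m x = flip n x -> m = n.
Proof.
move/(congr1 (fun f => f m)); rewrite flip_at /flip.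
by have [->|_] := eqVneq m n => //=; case: (x m).
Qed.

Lemma agree_flip n k x : (k <= n)%N -> agree k (flip n x) x.
Proof. by move=> kn i ik; rewrite flip_neq // neq_ltn (leq_trans ik). Qed.

Lemma agree_flip2 n k x y : agree k x y -> agree k (flip n x) (flip n y).
Proof. by move=> xy i ik; rewrite /flip xy. Qed.

Lemma agree_sym T k (x y : nat -> T) : agree k x y -> agree k y x.
Proof. by move=> xy i /xy. Qed.

Lemma agree_trans T k (y x z : nat -> T) : agree k x y -> agree k y z -> agree k x z.
Proof. by move=> xy yz i ik; rewrite xy// yz. Qed.

Lemma agree_le T k l (x y : nat -> T) : (k <= l)%N -> agree l x y -> agree k x y.
Proof. by move=> kl xy i ik; apply: xy; apply: leq_trans kl. Qed.

Lemma ones_agree k x y : agree k x y -> ones x k = ones y k.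
Proof. by move=> xy; apply: eq_bigr => i _; rewrite xy. Qed.

Lemma ones_flip_ge n k x : (k <= n)%N -> ones (flip n x) k = ones x k.
Proof. by move=> kn; apply/ones_agree/agree_flip. Qed.

Lemma onesS x k : ones x k.+1 = (ones x k + x k)%N.
Proof. by rewrite /ones big_ord_recr. Qed.

Lemma ones_flip_lt n k x : (n < k)%N ->
  (ones (flip n x) k + x n = ones x k + ~~ x n)%N.
Proof.
elim: k => // k IH; rewrite ltnS leq_eqVlt !onesS => /predU1P[<-|nk].
  by rewrite ones_flip_ge// flip_at; lia.
by rewrite flip_neq ?gtn_eqF//; have := IH nk; lia.
Qed.

Lemma ones_le x k : (ones x k <= k)%N.
Proof.
by elim: k => [|k IH]; rewrite ?/ones ?big_ord0 // -/(ones _ _) onesS; lia.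
Qed.

Lemma toeplitz_surj a r (b : bool) :
  exists2 v, (r <= v <= r.*2.+1)%N & toeplitz a v = b.
Proof.
have [ab|nab] := eqVneq (a r) b.
  exists r.*2; first by lia.
  by rewrite /toeplitz doubleK odd_double addbF.
exists r.*2.+1; first by lia.
rewrite /toeplitz/= odd_double uphalf_double.
by case: (a r) b nab => -[].
Qed.

Lemma logn2_addl v c : (2 ^ v.+1 %| c)%N -> logn 2 (c + 2 ^ v) = v.
Proof.
case/dvdnP => q ->; rewrite expnS mulnA -[X in (_ + X)%N]mul1n -mulnDl.
rewrite lognM ?expn_gt0//; last by rewrite addn1.
have qn : (2 %| q * 2 + 1)%N = false by rewrite dvdn2 oddD oddM andbF.
by rewrite pfactorK// lognE qn !andbF.
Qed.

(** A valuation below [r] is determined by the residue modulo [2 ^ r]. *)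
Lemma logn2_mod r (x y : nat) : ~~ (2 ^ r %| x)%N -> (2 ^ r %| `|x - y|)%N ->
  (0 < y)%N /\ logn 2 x = logn 2 y.
Proof.
move=> rx rxy.
have ry : ~~ (2 ^ r %| y)%N.
  apply: contra rx => ry.
  have [xy|yx] := leqP x y.
    by rewrite distnEr// dvdn_subr// in rxy.
  by rewrite distnEl ?(ltnW yx)// dvdn_subl ?(ltnW yx)// in rxy.
have x0 : (0 < x)%N by rewrite lt0n; apply: contra rx => /eqP ->; rewrite dvdn0.
have y0 : (0 < y)%N by rewrite lt0n; apply: contra ry => /eqP ->; rewrite dvdn0.
split=> //.
rewrite pfactor_dvdn// -ltnNge in rx; rewrite pfactor_dvdn// -ltnNge in ry.
have E u w : (0 < u)%N -> (0 < w)%N -> (logn 2 u < r)%N ->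
    (2 ^ r %| `|u - w|)%N -> (logn 2 u <= logn 2 w)%N.
  move=> u0 w0 ur ruw; rewrite -pfactor_dvdn//.
  have uu : (2 ^ logn 2 u %| u)%N by rewrite pfactor_dvdn.
  have {}ruw : (2 ^ logn 2 u %| `|u - w|)%N.
    by apply: dvdn_trans ruw; rewrite dvdn_exp2l// ltnW.
  have [xy|yx] := leqP u w.
    by rewrite distnEr// dvdn_subl// in ruw.
  by rewrite distnEl ?(ltnW yx)// dvdn_subr ?(ltnW yx)// in ruw.
by apply/eqP; rewrite eqn_leq !E// distnC.
Qed.

(** Take [v] with [k < 2 ^ v] carrying the letter true, and go to a position congruent to [2 ^ v]
    modulo [2 ^ v.+1]. It has the letter of 0, and adding [c] with [0 < c <= k] gives a number with
    the valuation of [c]. *)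
Lemma levels_recurrent a k : exists N, forall T, exists2 j, (j <= N)%N &
  forall c, (c <= k)%N -> levels a (T + j + c) = levels a c.
Proof.
have [v /andP[kv _] av] := toeplitz_surj a k.+1 true.
have kv2 : (k < 2 ^ v)%N by apply: leq_trans kv _; rewrite ltnW// ltn_expl.
exists (2 ^ v.+1 + 2 ^ v)%N => T.
set q := (2 ^ v.+1)%N.
have q0 : (0 < q)%N by rewrite expn_gt0.
exists (q * (T %/ q).+1 + 2 ^ v - T)%N.
  by have := divn_eq T q; have := ltn_pmod T q0; nia.
move=> c ck; rewrite subnKC; last first.
  by have := divn_eq T q; have := ltn_pmod T q0; nia.
have [->|c0] := posnP c.
  rewrite addn0 {2}/levels eqxx/= /levels logn2_addl ?av ?orbT//.
  by rewrite dvdn_mulr.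
rewrite /levels gtn_eqF 1?gtn_eqF//= ?addn_gt0 ?c0 ?orbT//.
congr toeplitz; symmetry.
apply: (@logn2_mod v _ _ _ _).2.
  by apply/negP => /dvdn_leq -/(_ c0); rewrite leqNgt (leq_ltn_trans ck).
rewrite distnEr ?leq_addl// addnK dvdn_add// dvdn_mulr// dvdn_exp2l//.
Qed.

(* A window of the Toeplitz word determines its phase, because the only residue
   class modulo a power of 2 on which it is not constant is that of 0; the phase
   then reads off the values of [toeplitz]. *)
Lemma levels_window a b :
  (forall k, exists T (g : nat -> nat),
    (forall i j, (i <= k)%N -> (j <= k)%N ->
      `|g i - g j|%N = `|i - j|%N) /\
    forall j, (j <= k)%N -> levels a (T + j) = levels b (g j)) ->
  a = b.
Proof.
move=> win.
suff tab n : toeplitz a n = toeplitz b n.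
  by apply/funext => i; have := tab i.*2; rewrite /toeplitz doubleK odd_double !addbF.
have [v /andP[nv _] av] := toeplitz_surj a n.+1 true.
have [w /andP[nw _] aw] := toeplitz_surj a n.+1 false.
set q := (2 ^ (v + w).+1)%N.
have [T [g [gi ab]]] := win (q + (2 ^ v + (2 ^ w + 2 ^ n)))%N.
have q0 : (0 < q)%N by rewrite expn_gt0.
(* [T + d] is a multiple of [q]; from there, the letter at distance [2 ^ i] is [toeplitz a i]. *)
set d := (q * (T %/ q).+1 - T)%N.
have Td : (T + d)%N = (q * (T %/ q).+1)%N.
  by rewrite /d; have := divn_eq T q; have := ltn_pmod T q0; nia.
have dq : (d <= q)%N.
  by rewrite /d; have := divn_eq T q; have := ltn_pmod T q0; nia.
have qTd i : (i <= v + w)%N -> (2 ^ i.+1 %| T + d)%N.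
  by move=> ivw; rewrite Td dvdn_mulr// dvdn_exp2l.
have lev i : (i <= v + w)%N -> levels a (T + d + 2 ^ i) = toeplitz a i.
  move=> ivw; rewrite /levels logn2_addl ?qTd//.
  by rewrite gtn_eqF// addn_gt0 expn_gt0 orbT.
pose j0 := (d + 2 ^ v)%N; pose j1 := (d + 2 ^ w)%N.
have n1 i : (n < i)%N -> (2 ^ n.+1 %| 2 ^ i)%N by move=> ?; rewrite dvdn_exp2l.
have dj : (2 ^ n.+1 %| `|g j0 - g j1|)%N.
  rewrite gi; [|lia|lia]; rewrite /j0 /j1 distnDl.
  have [vw|vw] := leqP (2 ^ v)%N (2 ^ w)%N.
    by rewrite distnEr// dvdn_sub// n1.
  by rewrite distnEl ?(ltnW vw)// dvdn_sub// n1.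
(* Otherwise [g j0] and [g j1], congruent modulo [2 ^ n.+1], would carry the same letter of [b],
   while [a] has true at valuation [v] and false at valuation [w]. *)
have g0 : (2 ^ n.+1 %| g j0)%N.
  apply: contraT => ng0; have [g1 gE] := logn2_mod ng0 dj.
  have g00 : (0 < g j0)%N by rewrite lt0n; apply: contra ng0 => /eqP ->; rewrite dvdn0.
  have : levels b (g j0) = levels b (g j1) by rewrite /levels gE !gtn_eqF.
  by rewrite -!ab; [rewrite /j0 /j1 !addnA !lev ?av ?aw// ?leq_addr ?leq_addl|lia|lia].
pose j2 := (j0 + 2 ^ n)%N.
have g2 : `|g j2 - g j0|%N = (2 ^ n)%N.
  rewrite gi; [|by rewrite /j2 /j0; clear -dq; lia|by rewrite /j0; clear -dq; lia].
  by rewrite /j2 distnEl ?leq_addr// addKn.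
(* [g j2] lies [2 ^ n] above or below a multiple of [2 ^ n.+1]; the valuation is [n] in both
   cases. *)
have lgn : (0 < g j2)%N /\ logn 2 (g j2) = n.
  have n0 : (0 < 2 ^ n)%N by rewrite expn_gt0.
  have [g20|g20] := leqP (g j0) (g j2).
    have -> : g j2 = (g j0 + 2 ^ n)%N by clear -g2 g20; lia.
    by split; [rewrite addn_gt0 n0 orbT|exact: logn2_addl].
  have g0E : g j0 = (g j2 + 2 ^ n)%N by clear -g2 g20; lia.
  have g22 : (2 ^ n.+1 %| g j0 - 2 ^ n.+1)%N.
    by rewrite dvdn_sub.
  have := dvdn_leq (leq_trans (leq_ltn_trans (leq0n _) g20) (leqnn _)) g0.
  rewrite expnS => g0n.
  have -> : g j2 = (g j0 - 2 ^ n.+1 + 2 ^ n)%N.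
    by rewrite expnS; clear -g0E g0n; lia.
  by split; [rewrite addn_gt0 n0 orbT|exact: logn2_addl].
have -> : toeplitz a n = levels a (T + j2).
  rewrite /levels -[toeplitz a n]/(false || _).
  have -> : (T + j2 = T + d + 2 ^ v + 2 ^ n)%N by rewrite /j2 /j0 !addnA.
  rewrite logn2_addl; last by rewrite dvdn_add ?n1// qTd//; lia.
  by rewrite gtn_eqF// addn_gt0 expn_gt0 orbT.
rewrite ab; last by rewrite /j2 /j0; lia.
by rewrite /levels lgn.2 gtn_eqF// lgn.1.
Qed.

(** * Analytic sets and the ideal of small sets *)

Lemma ex_choice (X Y : Type) (P : X -> Y -> Prop) :
  (forall x, exists y, P x y) -> exists f, forall x, P x (f x).
Proof. by move=> /choice[f fP]; exists f. Qed.

Lemma dependent_sequence (S : Type) (I : nat -> S -> Prop)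
    (R : nat -> S -> S -> Prop) (s0 : S) :
  I 0%N s0 -> (forall n s, I n s -> exists s', I n.+1 s' /\ R n s s') ->
  exists f : nat -> S, f 0%N = s0 /\ forall n, I n (f n) /\ R n (f n) (f n.+1).
Proof.
move=> I0 step.
have [g gP] : exists g : nat * S -> S, forall p, I p.1 p.2 ->
    I p.1.+1 (g p) /\ R p.1 p.2 (g p).
  apply: (ex_choice (P := fun p s' =>
    I p.1 p.2 -> I p.1.+1 s' /\ R p.1 p.2 s')) => -[n s]; have [Is|nIs] := pselect (I n s).
    by have [s' ?] := step _ _ Is; exists s'.
  by exists s.
pose f := fix f n := if n is n'.+1 then g (n', f n') else s0.
have If n : I n (f n) by elim: n => //= n /(gP (n, f n)) [].
by exists f; split=> // n; split=> //; exact: (gP (n, f n) (If n)).2.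
Qed.

Lemma ex_bound (f : nat -> nat) k : exists l, forall j, (j < k)%N -> (f j < l)%N.
Proof.
elim: k => [|k [l fl]]; first by exists 0%N.
exists (maxn l (f k).+1) => j; rewrite ltnS leq_eqVlt => /predU1P[->|/fl].
  by rewrite leq_max leqnn orbT.
by rewrite leq_max => ->.
Qed.

Lemma bigcup_countType (T : Type) (J : countType) (A : J -> set T) :
  \bigcup_j A j = \bigcup_n (if unpickle n is Some j then A j else set0).
Proof.
apply/seteqP; split=> x [].
  by move=> j _ Ajx; exists (pickle j) => //; rewrite pickleK.
by move=> n _; case: unpickle => // j Ajx; exists j.
Qed.

(** * Borel and analytic subsets of the Cantor space *)

Definition bit (n : nat) : set (nat -> bool) := [set x | x n].

Inductive bor : set (nat -> bool) -> Prop :=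
  | bor_coord n : bor (bit n)
  | bor_setC A : bor A -> bor (~` A)
  | bor_bigcup (A : nat -> set (nat -> bool)) :
      (forall i, bor (A i)) -> bor (\bigcup_i A i).

Lemma bor_setU A B : bor A -> bor B -> bor (A `|` B).
Proof.
move=> bA bB; have -> : A `|` B = \bigcup_n (if n is 0 then A else B).
  apply/seteqP; split=> [x [Ax|Bx]|x [[|n] _ ?]]; [| |by left|by right].
    by exists 0%N.
  by exists 1%N.
by apply: bor_bigcup => -[].
Qed.

Lemma borT : bor setT.
Proof. by rewrite -(setUv (bit 0)); apply/bor_setU/bor_setC/bor_coord/bor_coord. Qed.

Lemma bor0 : bor set0.
Proof. rewrite -setCT; exact/bor_setC/borT. Qed.

Lemma bor_countable_bigcup (J : countType) (A : J -> set (nat -> bool)) :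
  (forall j, bor (A j)) -> bor (\bigcup_j A j).
Proof.
move=> bA; rewrite bigcup_countType; apply: bor_bigcup => n.
by case: unpickle => // ; apply: bor0.
Qed.

Lemma bor_bigcap (A : nat -> set (nat -> bool)) :
  (forall i, bor (A i)) -> bor (\bigcap_i A i).
Proof.
move=> bA; rewrite -(setCK (\bigcap_i _)) setC_bigcap.
by apply/bor_setC/bor_bigcup => i; apply/bor_setC.
Qed.

Lemma bor_setI A B : bor A -> bor B -> bor (A `&` B).
Proof.
move=> bA bB; rewrite -(setCK (_ `&` _)) setCI.
by apply/bor_setC/bor_setU; apply/bor_setC.
Qed.

Lemma bor_flip n A : bor A -> bor (flip n @^-1` A).
Proof.
elim=> [m|{}A _ bA|{}A _ bA].
- have [->|mn] := eqVneq m n.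
    rewrite (_ : _ @^-1` _ = ~` bit n); first exact/bor_setC/bor_coord.
    by apply/seteqP; split=> x; rewrite /bit/= flip_at => /negP.
  rewrite (_ : _ @^-1` _ = bit m); first exact/bor_coord.
  by apply/seteqP; split=> x; rewrite /bit/= flip_neq.
- by rewrite preimage_setC; exact: bor_setC.
- by rewrite preimage_bigcup; exact: bor_bigcup.
Qed.

Definition closed_rel (T : (nat -> bool) -> (nat -> nat) -> Prop) : Prop :=
  forall x y,
    (forall k, exists x' y', [/\ T x' y', agree k x x' & agree k y y']) -> T x y.

Definition analytic (Q : set (nat -> bool)) : Prop :=
  exists2 T, closed_rel T & Q = [set x | exists y, T x y].

Lemma analytic_bigcup (Q : nat -> set (nat -> bool)) :
  (forall i, analytic (Q i)) -> analytic (\bigcup_i Q i).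
Proof.
move=> aQ.
have /ex_choice[T TP] : forall i, exists T,
    closed_rel T /\ Q i = [set x | exists y, T x y].
  by move=> i; have [T ? ?] := aQ i; exists T.
exists (fun x y => T (y 0%N) x (fun i => y i.+1)).
  move=> x y xy; apply: (TP _).1 => k; have [x' [y' [Txy xx' yy']]] := xy k.+1.
  exists x', (fun i => y' i.+1); split; first by rewrite yy'.
    exact: agree_le xx'.
  by move=> i ik; apply: yy'.
apply/seteqP; split=> x.
  move=> [i _]; rewrite (TP i).2 => -[y Ty].
  by exists (fun j => if j is j'.+1 then y j' else i).
by move=> [y Ty]; exists (y 0%N) => //; rewrite (TP _).2; eexists; exact: Ty.
Qed.

Lemma analytic_bigcap (Q : nat -> set (nat -> bool)) :
  (forall i, analytic (Q i)) -> analytic (\bigcap_i Q i).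
Proof.
move=> aQ.
have /ex_choice[T TP] : forall i, exists T,
    closed_rel T /\ Q i = [set x | exists y, T x y].
  by move=> i; have [T ? ?] := aQ i; exists T.
exists (fun x y => forall i, T i x (fun j => y (pickle (i, j)))).
  move=> x y xy i; apply: (TP i).1 => k.
  have [l lP] := ex_bound (fun j => pickle (i, j)) k.
  have [x' [y' [Txy xx' yy']]] := xy (maxn k l).
  exists x', (fun j => y' (pickle (i, j))); split; first exact: Txy.
    by apply: agree_le xx'; rewrite leq_maxl.
  by move=> j /lP jl; apply: yy'; rewrite leq_max jl orbT.
apply/seteqP; split=> x.
  move=> Qx; have /ex_choice[y yP] : forall i, exists y, T i x y.
    by move=> i; have := Qx i I; rewrite (TP i).2.
  exists (fun n => if unpickle n is Some (i, j) then y i j else 0%N) => i.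
  by rewrite (_ : (fun j => _) = y i)//; apply/funext => j; rewrite pickleK.
by move=> [y Ty] i _; rewrite (TP i).2; eexists; exact: Ty.
Qed.

Lemma analyticT : analytic setT.
Proof.
by exists (fun _ _ => True) => //; apply/seteqP; split=> // x _; exists (fun=> 0%N).
Qed.

Lemma analytic_countable_bigcap (J : countType) (Q : J -> set (nat -> bool)) :
  (forall j, analytic (Q j)) -> analytic (\bigcap_j Q j).
Proof.
move=> aQ.
have -> : \bigcap_j Q j = \bigcap_n (if unpickle n is Some j then Q j else setT).
  apply/seteqP; split=> x Qx.
    by move=> n _; case: unpickle => // j; exact: Qx.
  by move=> j _; have := Qx (pickle j) I; rewrite pickleK.
by apply: analytic_bigcap => n; case: unpickle => // ; apply: analyticT.
Qed.

Lemma analytic_setI P Q : analytic P -> analytic Q -> analytic (P `&` Q).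
Proof.
move=> aP aQ; have -> : P `&` Q = \bigcap_n (if n is 0 then P else Q).
  apply/seteqP; split=> [x [Px Qx] [|n] _ //|x PQ].
  by split; [exact: (PQ 0%N)|exact: (PQ 1%N)].
by apply: analytic_bigcap => -[].
Qed.

Lemma analytic_flip n Q : analytic Q -> analytic (flip n @^-1` Q).
Proof.
move=> [T cT ->]; exists (fun x y => T (flip n x) y) => //.
move=> x y xy; apply: cT => k; have [x' [y' [Txy xx' yy']]] := xy k.
by exists (flip n x'), y'; split=> //; exact: agree_flip2.
Qed.

Lemma bor_analytic A : bor A -> analytic A.
Proof.
(* Analytic sets are not closed under complement, so the induction carries both sides. *)
move=> bA; suff [] : analytic A /\ analytic (~` A) by [].
elim: bA => [n|{}A _ [aA aCA]|{}A _ aA]; last 2 first.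
- by rewrite setCK.
- split; first by apply: analytic_bigcup => i; have [] := aA i.
  by rewrite setC_bigcup; apply: analytic_bigcap => i; have [] := aA i.
have cn b : closed_rel (fun x _ => x n = b).
  by move=> x y /(_ n.+1)[x' [y' [<- xx' _]]]; apply: xx'.
split; [exists (fun x _ => x n = true) => //|exists (fun x _ => x n = false) => //].
  by apply/seteqP; split=> [x ?|x []//]; exists (fun=> 0%N).
apply/seteqP; split=> [x /negP/negbTE ?|x [_ /= xn]]; first by exists (fun=> 0%N).
by rewrite /setC/bit/= xn.
Qed.

(** * Lusin separation *)

Definition bor_separated (P Q : set (nat -> bool)) : Prop :=
  exists B, [/\ bor B, P `<=` B & Q `<=` ~` B].

Lemma bor_separated_bigcup (J : countType) (P Q : J -> set (nat -> bool)) :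
  (forall i j, bor_separated (P i) (Q j)) ->
  bor_separated (\bigcup_i P i) (\bigcup_j Q j).
Proof.
move=> sep.
have /ex_choice[B BP] : forall p : J * J, exists B,
    [/\ bor B, P p.1 `<=` B & Q p.2 `<=` ~` B].
  by move=> [i j]; exact: sep.
exists (\bigcup_i ~` \bigcup_j ~` B (i, j)); split.
- apply: bor_countable_bigcup => i; apply/bor_setC/bor_countable_bigcup => j.
  by apply: bor_setC; case: (BP (i, j)).
- move=> x [i _ Px]; exists i => // -[j _]; apply.
  by have [_ + _] := BP (i, j); apply.
- move=> x [j _ Qx] [i _]; apply; exists j => //.
  by have [_ _] := BP (i, j); apply.
Qed.

(** Both sets are split according to initial segments of point and witness. If they are inseparable,
    some pair of one-step extensions is again inseparable, and iterating gives a limit pair in each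
    closed relation. *)
Lemma lusin_separation (P Q : set (nat -> bool)) :
  analytic P -> analytic Q -> (forall x, P x -> ~ Q x) -> bor_separated P Q.
Proof.
move=> [T cT PE] [U cU QE] PQ0.
pose part (V : (nat -> bool) -> (nat -> nat) -> Prop) (s : seq (bool * nat)) :=
  [set x | exists2 y, V x y & agree (size s) (fun i => (x i, y i)) (nth (false, 0%N) s)].
have part0 V : part V [::] = [set x | exists y, V x y].
  by apply/seteqP; split=> x [y]; exists y.
have partS V s : part V s = \bigcup_c part V (rcons s c).
  apply/seteqP; split=> x.
    move=> [y Vxy xys]; exists (x (size s), y (size s)) => //; exists y => //.
    move=> i; rewrite size_rcons ltnS leq_eqVlt nth_rcons => /predU1P[->|/[dup] i_s ->].
      by rewrite ltnn eqxx.
    exact: xys.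
  move=> [c _ [y Vxy xys]]; exists y => // i i_s.
  by rewrite xys ?size_rcons 1?ltnW// nth_rcons i_s.
apply: contrapT => nsep.
pose S := (seq (bool * nat) * seq (bool * nat))%type.
have [||f [f0 fP]] := @dependent_sequence S
  (fun n s => [/\ size s.1 = n, size s.2 = n & ~ bor_separated (part T s.1) (part U s.2)])
  (fun n s s' => exists c d, s' = (rcons s.1 c, rcons s.2 d)) ([::], [::]).
- by split=> //; rewrite !part0 -PE -QE.
- move=> n [s t]/= [sn tn nst].
  have [c [d ncd]] : exists c d,
      ~ bor_separated (part T (rcons s c)) (part U (rcons t d)).
    apply: contrapT => /forallNP h; apply: nst; rewrite partS (partS U).
    apply: bor_separated_bigcup => c d; apply: contrapT => ncd.
    by apply: (h c); exists d.
  by exists (rcons s c, rcons t d); split; [rewrite !size_rcons sn tn|exists c, d].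
pose x i := (nth (false, 0%N) (f i.+1).1 i).1.
pose y i := (nth (false, 0%N) (f i.+1).1 i).2.
pose x' i := (nth (false, 0%N) (f i.+1).2 i).1.
pose y' i := (nth (false, 0%N) (f i.+1).2 i).2.
have fst_stable n : agree n (nth (false, 0%N) (f n).1) (fun i => (x i, y i)).
  elim: n => // n IH i; rewrite ltnS leq_eqVlt => /predU1P[->|i_n].
    by rewrite /x /y -surjective_pairing.
  rewrite -IH//; have [[sn _ _] [c [d ->]]] := fP n.
  by rewrite /= nth_rcons sn i_n.
have snd_stable n : agree n (nth (false, 0%N) (f n).2) (fun i => (x' i, y' i)).
  elim: n => // n IH i; rewrite ltnS leq_eqVlt => /predU1P[->|i_n].
    by rewrite /x' /y' -surjective_pairing.
  rewrite -IH//; have [[_ sn _] [c [d ->]]] := fP n.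
  by rewrite /= nth_rcons sn i_n.
(* If the limit points coincide, closedness puts one point in both sets, because an empty part would
   be separated trivially. If they differ at [i], the bit [i] separates the parts of stage
   [i.+1]. *)
have [xx'|xx'] := pselect (x = x').
  apply: (PQ0 x); [rewrite PE; exists y; apply: cT|rewrite QE; exists y'; apply: cU] => k;
      have [[sn tn nsepn] _] := fP k; apply: contrapT => h; apply: nsepn.
    exists set0; split; [exact: bor0| |by move=> ? _ []].
    move=> z [w Tzw zw]; apply: h; exists z, w; rewrite sn in zw.
    by split=> // i ik; have := zw i ik; rewrite fst_stable// => -[].
  exists setT; split; [exact: borT|by []|].
  move=> z [w Tzw zw] _; apply: h; exists z, w; rewrite tn in zw.
  by split=> // i ik; have := zw i ik; rewrite snd_stable// => -[]; rewrite ?xx'.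
have [i xi] : exists i, x i <> x' i.
  by apply: contrapT => /forallNP h; apply: xx'; apply/funext => i; apply: contrapT => /h.
have [[sn tn nsepn] _] := fP i.+1; apply: nsepn.
exists (if x i then bit i else ~` bit i); split.
- by case: (x i); [exact: bor_coord|exact/bor_setC/bor_coord].
- move=> z [w _ zw]; rewrite sn in zw; have := zw i (ltnSn i).
  by rewrite fst_stable// => -[zx _]; case: (x i) zx; rewrite /setC/bit/= => ->.
- move=> z [w _ zw]; rewrite tn in zw; have := zw i (ltnSn i).
  rewrite snd_stable// => -[zx _]; move: xi; rewrite -zx.
  by case: (x i); rewrite /setC/bit/=; case: (z i) => h; first [by case: (h erefl)|by []|by apply].
Qed.

(** * The ideal of small sets *)

Definition flip_discrete (B : set (nat -> bool)) : Prop :=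
  forall n x, B x -> ~ B (flip n x).

Definition small (Q : set (nat -> bool)) : Prop :=
  exists2 B : nat -> set (nat -> bool),
    forall i, bor (B i) /\ flip_discrete (B i) & Q `<=` \bigcup_i B i.

Lemma small_sub P Q : P `<=` Q -> small Q -> small P.
Proof. by move=> PQ [B BP QB]; exists B => //; apply: subset_trans QB. Qed.

Lemma small0 : small set0.
Proof.
by exists (fun=> set0) => // i; split=> //; exact: bor0.
Qed.

Lemma small_bigcup (J : countType) (Q : J -> set (nat -> bool)) :
  (forall j, small (Q j)) -> small (\bigcup_j Q j).
Proof.
move=> sQ; have /ex_choice[B BP] : forall j, exists B : nat -> set (nat -> bool),
    (forall i, bor (B i) /\ flip_discrete (B i)) /\ Q j `<=` \bigcup_i B i.
  by move=> j; have [B ? ?] := sQ j; exists B.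
exists (fun n => if unpickle n is Some (j, i) then B j i else set0).
  move=> n; case: unpickle => [[j i]|]; first exact: (BP j).1.
  by split=> //; exact: bor0.
move=> x [j _ /(BP j).2[i _ Bx]]; exists (pickle (j, i)) => //.
by rewrite pickleK.
Qed.

Lemma small_flip n Q : small Q -> small (flip n @^-1` Q).
Proof.
move=> [B BP QB]; exists (fun i => flip n @^-1` B i).
  move=> i; split; first exact/bor_flip/(BP i).1.
  by move=> m x /= Bx; rewrite flipC; exact: (BP i).2.
by move=> x /QB[i _ Bx]; exists i.
Qed.

(** For each [n], a Borel [B n] separates [Q] from its flip at [n]. The points lying in every [B n]
    and outside its flip form a Borel set without adjacent points which contains [Q]. *)
Lemma analytic_flip_discrete_small Q : analytic Q -> flip_discrete Q -> small Q.
Proof.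
move=> aQ dQ.
have /ex_choice[B BP] : forall n, exists B,
    [/\ bor B, Q `<=` B & flip n @^-1` Q `<=` ~` B].
  move=> n; apply: lusin_separation => //; first exact: analytic_flip.
  by move=> x Qx; exact: dQ.
exists (fun=> \bigcap_n (B n `&` ~` (flip n @^-1` B n))).
  move=> _; split.
    apply: bor_bigcap => n; have [bB _ _] := BP n.
    exact/bor_setI/bor_setC/bor_flip.
  by move=> n x /(_ n I)[_ nB] /(_ n I)[].
move=> x Qx; exists 0%N => // n _; have [_ QB CB] := BP n; split; first exact: QB.
by move=> /=; apply: CB; rewrite /= flipK.
Qed.

Definition flip_pairs (Q : set (nat -> bool)) (m T : nat) : set (nat -> bool) :=
  [set x | [/\ Q x, Q (flip m x), x m = false & ones x m = T]].

Lemma bor_ones m T : bor [set x | ones x m = T].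
Proof.
elim: m T => [|m IH] T.
  have -> : [set x | ones x 0 = T] = if T is 0 then setT else set0.
    by case: T => [|T]; apply/seteqP; split=> x; rewrite /= /ones big_ord0.
  by case: T => [|T]; [exact: borT|exact: bor0].
have -> : [set x | ones x m.+1 = T] = (~` bit m `&` [set x | ones x m = T])
    `|` (bit m `&` (if T is T'.+1 then [set x | ones x m = T'] else set0)).
  apply/seteqP; split=> x; rewrite /setU/setI/setC/bit/= onesS.
    case: (x m); last by rewrite addn0 => ->; left.
    by rewrite addn1 => <-; right.
  case=> [[/negP/negbTE -> /= ->]|[xm]]; first by rewrite addn0.
  by case: T {IH} => // T /= ->; rewrite xm addn1.
apply: bor_setU; apply: bor_setI; rewrite //.
- exact/bor_setC/bor_coord.
- exact: bor_coord.
- by case: T; [exact: bor0|exact: IH].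
Qed.

Lemma analytic_flip_pairs Q m T : analytic Q -> analytic (flip_pairs Q m T).
Proof.
move=> aQ.
have -> : flip_pairs Q m T = Q `&` (flip m @^-1` Q `&`
    (~` bit m `&` [set x | ones x m = T])).
  apply/seteqP; split=> x; last by move=> [Qx [Qf [/negP/negbTE xm oT]]].
  by move=> [Qx Qf xm oT]; do 3!split=> //; rewrite /bit/= xm.
apply: analytic_setI => //; apply: analytic_setI; first exact: analytic_flip.
apply: bor_analytic; apply: bor_setI; last exact: bor_ones.
exact/bor_setC/bor_coord.
Qed.

(* If all the sets [flip_pairs Q m T] were small, then off a small set [Q] would
   be a finite union of sets without two points one flip apart. *)
Lemma flip_pairs_not_small Q L : analytic Q -> ~ small Q ->
  exists m T, (L <= m)%N /\ ~ small (flip_pairs Q m T).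
Proof.
move=> aQ nQ; apply: contrapT => /forallNP h; apply: nQ.
have sp (p : nat * nat) : small (if (L <= p.1)%N then flip_pairs Q p.1 p.2 else set0).
  case: ifP => Lp; last exact: small0.
  by apply: contrapT => ns; apply: (h p.1); exists p.2.
have [B BP QB] := small_bigcup sp.
(* A flip below [L] would change a bit prescribed by [s], and a flip from [L] on would put one of
   the two points into the discarded small set. *)
pose Q' (s : seq bool) := Q `&` (~` (\bigcup_i B i) `&`
   \bigcap_i [set x | (i < L)%N -> x i = nth false s i]).
have sQ' s : small (Q' s).
  apply: analytic_flip_discrete_small.
    apply: analytic_setI => //; apply: bor_analytic.
    apply: bor_setI.
      by apply/bor_setC/bor_bigcup => i; have [] := BP i.
    apply: bor_bigcap => i; have [iL|iL] := ltnP i L; last first.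
      by rewrite (_ : [set _ | _] = setT); [exact: borT|apply/seteqP; split].
    case: (nth false s i).
      rewrite (_ : [set _ | _] = bit i); first exact: bor_coord.
      by apply/seteqP; split=> x /=; [apply|].
    rewrite (_ : [set _ | _] = ~` bit i); first exact/bor_setC/bor_coord.
    by apply/seteqP; split=> x; rewrite /setC/bit/=; [move=> ->|move/negP/negbTE].
  have key n x : Q' s x -> Q' s (flip n x) -> x n = false -> False.
    move=> [Qx [nBx xs]] [Qfx [_ fxs]] xn; apply: nBx; apply: QB.
    exists (n, ones x n) => //=; have [//|nL] := leqP L n.
    have := fxs n I nL; rewrite -(xs n I nL) flip_at.
    by case: (x n).
  move=> n x Qx Qfx; case xn : (x n); last exact: (key n x).
  by apply: (key n (flip n x)) => //; [rewrite flipK|rewrite flip_at xn].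
have sBi i : small (B i) by exists B => // x Bx; exists i.
apply: (@small_sub _ ((\bigcup_i B i) `|` \bigcup_s Q' s)).
  move=> x Qx; have [?|nB] := pselect ((\bigcup_i B i) x); [by left|right].
  exists (mkseq x L) => //; do 2!split=> //.
  by move=> i _ iL; rewrite nth_mkseq.
have -> : (\bigcup_i B i) `|` \bigcup_s Q' s =
    \bigcup_(b : bool) (if b then \bigcup_i B i else \bigcup_s Q' s).
  apply/seteqP; split=> [x [?|?]|x [[] _ ?]]; [by exists true|by exists false|by left|by right].
apply: small_bigcup => -[]; last exact: small_bigcup.
by exists B.
Qed.

(** The induction is applied inside [flip_pairs Q l t], with [m] beyond [l]. Flipping the zero at
    [l] adds a one before [m] and preserves the ideal, so the last value of the window yields one
    more. *)
Lemma flip_pairs_window Q N L : analytic Q -> ~ small Q -> exists m T,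
  (L <= m)%N /\ forall j, (j <= N)%N -> ~ small (flip_pairs Q m (T + j)).
Proof.
elim: N Q L => [|N IH] Q L aQ nQ.
  have [m [T [Lm nmT]]] := flip_pairs_not_small L aQ nQ.
  by exists m, T; split=> // j; rewrite leqn0 => /eqP ->; rewrite addn0.
have [l [t [Ll nlt]]] := flip_pairs_not_small L aQ nQ.
have [m [T [lm nmT]]] := IH _ l.+1 (analytic_flip_pairs l t aQ) nlt.
exists m, T; split=> [|j]; first by rewrite (leq_trans Ll)// ltnW.
rewrite leq_eqVlt ltnS => /predU1P[->|/nmT]; last first.
  by apply: contra_not; apply: small_sub => x [[? _ _ _] [? _ _ _] ? ?].
have := nmT N (leqnn N); apply: contra_not => /(small_flip l); apply: small_sub.
move=> x [[Qx Qlx xl _] [_ Qlmx _ _] xm onesx]; split=> //.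
- by rewrite flipC.
- by rewrite flip_neq// gtn_eqF.
- by have := ones_flip_lt x lm; rewrite xl onesx addn0 addn1 addnS.
Qed.

(** A window as long as the recurrence bound contains a number of ones after which the word repeats
    its beginning. *)
Lemma flip_pairs_levels a Q k L : analytic Q -> ~ small Q -> exists m T,
  [/\ (L <= m)%N, forall c, (c <= k)%N -> levels a (T + c) = levels a c &
      ~ small (flip_pairs Q m T)].
Proof.
move=> aQ nQ; have [N NP] := levels_recurrent a k.
have [m [T [Lm nmT]]] := flip_pairs_window N L aQ nQ.
by have [j jN lev] := NP T; exists m, (T + j)%N; split=> //; exact: nmT.
Qed.

(** * Self-embeddings into analytic sets that are not small *)

Fixpoint shift (m : nat -> nat) (z : nat -> bool) (k : nat) (x : nat -> bool) :
    nat -> bool :=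
  if k is k'.+1 then
    let y := shift m z k' x in if z k' then flip (m k') y else y
  else x.

Lemma shift_agree m m' z z' k x : agree k m m' -> agree k z z' ->
  shift m z k x = shift m' z' k x.
Proof.
elim: k => //= k IH mm' zz'.
by rewrite IH ?mm' ?zz' //; [exact: agree_le mm'|exact: agree_le zz'].
Qed.

Lemma shift_flipr m z k n x : shift m z k (flip n x) = flip n (shift m z k x).
Proof. by elim: k => //= k ->; case: ifP => // _; rewrite flipC. Qed.

Lemma shift_flipl m z k i x : (i < k)%N ->
  shift m (flip i z) k x = flip (m i) (shift m z k x).
Proof.
elim: k => //= k IH; rewrite ltnS leq_eqVlt => /predU1P[->|ik].
  rewrite flip_at (@shift_agree m m (flip k z) z)//; last exact: agree_flip.
  by case: (z k); rewrite //= flipK.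
by rewrite IH// flip_neq ?gtn_eqF//; case: ifP => // _; rewrite flipC.
Qed.

Definition increasing_below (k : nat) (m : nat -> nat) : Prop :=
  forall i j, (i < j < k)%N -> (m i < m j)%N.

Lemma shift_at m z k i x : increasing_below k m -> (i < k)%N ->
  x (m i) = false -> shift m z k x (m i) = z i.
Proof.
move=> mi ik xi.
have E l : (i < l <= k)%N -> shift m z l x (m i) = z i.
  elim: l => // l IH /andP[]; rewrite ltnS leq_eqVlt => /predU1P[<- _|il lk] /=.
    have {IH} E0 j : (j <= i)%N -> shift m z j x (m i) = false.
      elim: j => //= j IHj ji.
      have mji : (m j < m i)%N by apply: mi; rewrite ji.
      by case: (z j); rewrite ?flip_neq ?gtn_eqF//; apply: IHj; exact: ltnW.
    by case: (z i); rewrite ?flip_at E0.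
  rewrite (fun_if (fun f => f (m i))) flip_neq; last first.
    by rewrite ltn_eqF// mi// il.
  by rewrite if_same IH// il ltnW.
by apply: E; rewrite ik leqnn.
Qed.

Lemma ones_shift m z k i x : increasing_below k m -> (i < k)%N ->
  (forall j, (j < k)%N -> x (m j) = false) ->
  ones (shift m z k x) (m i) = (ones x (m i) + ones z i)%N.
Proof.
move=> mi ik x0.
(* Only the flips at [m j] with [j < i] fall before [m i], and each turns a zero of [x] into a
   one. *)
have E l : (l <= k)%N -> ones (shift m z l x) (m i) = (ones x (m i) + ones z (minn i l))%N.
  elim: l => [|l IH lk]; first by rewrite minn0 /= {3}/ones big_ord0 addn0.
  have [il|li] := leqP i l.
    rewrite (minn_idPl _) 1?ltnW//= (fun_if (fun f => ones f (m i))).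
    rewrite ones_flip_ge; last first.
      by move: il; rewrite leq_eqVlt => /predU1P[->//|il]; rewrite ltnW// mi// il.
    by rewrite if_same IH 1?ltnW// (minn_idPl _).
  rewrite (minn_idPr _)//= onesS addnA.
  have {}IH : ones (shift m z l x) (m i) = (ones x (m i) + ones z l)%N.
    by rewrite IH 1?ltnW// (minn_idPr _)// ltnW.
  have ml : (m l < m i)%N by rewrite mi// li.
  have sl : shift m z l x (m l) = false.
    have {IH} E0 j : (j <= l)%N -> shift m z j x (m l) = false.
      elim: j => [|j IHj jl] /=; first by rewrite x0// (ltn_trans li).
      have mjl : (m j < m l)%N by apply: mi; rewrite jl (ltn_trans li).
      by case: (z j); rewrite ?flip_neq ?gtn_eqF//; apply: IHj; exact: ltnW.
    exact: E0.
  case: (z l); rewrite ?addn0 -IH//.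
  by have := ones_flip_lt (shift m z l x) ml; rewrite sl addn0.
by rewrite E// (minn_idPl _)// ltnW.
Qed.

Lemma agree_mkseq k (z : nat -> bool) : agree k z (nth false (mkseq z k)).
Proof. by move=> i ik; rewrite nth_mkseq. Qed.

Lemma take_mkseq (T : Type) (z : nat -> T) k l : (k <= l)%N ->
  take k (mkseq z l) = mkseq z k.
Proof. by move=> kl; rewrite /mkseq -map_take take_iota (minn_idPl kl). Qed.

Lemma mkseq_agree (T : Type) k (z z' : nat -> T) : agree k z z' ->
  mkseq z k = mkseq z' k.
Proof.
by move=> zz'; apply/eq_in_map => i; rewrite mem_iota => /zz'.
Qed.

Section Embedding.
Variables (a : nat -> bool) (T : (nat -> bool) -> (nat -> nat) -> Prop).
Hypothesis cT : closed_rel T.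
Hypothesis nT : ~ small [set x | exists y, T x y].

(* An approximation of length [k]: the flipped coordinates [m i] and the number
   [c i] of ones before [m i], for [i < k], and for every [s] of length [k] an
   initial segment of length [k] of the point of [T] assigned to [s]. *)
Record approximation := Approximation {
  app_m : nat -> nat ;
  app_c : nat -> nat ;
  app_t : seq bool -> nat -> bool * nat }.

(** The length [l] of the prescribed segments is separate from [k] because a step first lengthens
    the segments and only then adds a flip. *)
Definition bases_upto (k l : nat) (p : approximation) : set (nat -> bool) :=
  [set x | (forall i, (i < k)%N -> x (app_m p i) = false /\
                        ones x (app_m p i) = app_c p i) /\
    forall s, size s = k ->
      exists2 y, T (shift (app_m p) (nth false s) k x) y &
        agree l (fun i => (shift (app_m p) (nth false s) k x i, y i)) (app_t p s)].

Definition bases (k : nat) : approximation -> set (nat -> bool) := bases_upto k k.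

Definition good (k : nat) (p : approximation) : Prop :=
  [/\ increasing_below k (app_m p),
      forall i c, (i < k)%N -> (c <= i)%N -> levels a (app_c p i + c) = levels a c
    & ~ small (bases k p)].

Definition extends (k : nat) (p q : approximation) : Prop :=
  [/\ agree k (app_m p) (app_m q), agree k (app_c p) (app_c q)
    & forall s, size s = k.+1 -> agree k (app_t q s) (app_t p (take k s))].

Lemma closed_rel_shift m z k (t : nat -> bool * nat) l :
  closed_rel (fun x y => T (shift m z k x) y /\
                         agree l (fun i => (shift m z k x i, y i)) t).
Proof.
move=> x y xy.
have sh n x' : agree n x x' -> agree n (shift m z k x) (shift m z k x').
  move=> xx'; elim: k {xy} => //= k IH.
  by case: (z k) => //; exact: agree_flip2.
split.
  apply: cT => n; have [x' [y' [[Txy _] xx' yy']]] := xy n.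
  by exists (shift m z k x'), y'; split=> //; exact: sh.
have [x' [y' [[_ txy] xx' yy']]] := xy l.
by move=> i il; rewrite -txy// yy'// (sh l x').
Qed.

Lemma analytic_bases k l p : analytic (bases_upto k l p).
Proof.
have -> : bases_upto k l p =
  \bigcap_i (if (i < k)%N then ~` bit (app_m p i) `&`
                [set x | ones x (app_m p i) = app_c p i] else setT) `&`
  \bigcap_s (if size s == k then
      [set x | exists y, T (shift (app_m p) (nth false s) k x) y /\
        agree l (fun i => (shift (app_m p) (nth false s) k x i, y i)) (app_t p s)]
     else setT).
  apply/seteqP; split=> x.
    move=> [x0 xs]; split=> [i|s] _.
      case: ifP => // ik; have [xi oi] := x0 i ik.
      by split=> //; rewrite /setC/bit/= xi.
    by case: eqP => // /xs[y ? ?]; exists y.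
  move=> [x0 xs]; split=> [i ik|s sk].
    by have := x0 i I; rewrite ik => -[/negP/negbTE].
  by have := xs s I; rewrite sk eqxx => -[y []]; exists y.
apply: analytic_setI.
  apply: analytic_bigcap => i; case: ifP => _; last exact: analyticT.
  apply: bor_analytic; apply: bor_setI; last exact: bor_ones.
  exact/bor_setC/bor_coord.
apply: analytic_countable_bigcap => s; case: ifP => _; last exact: analyticT.
by eexists; [exact: (@closed_rel_shift (app_m p) (nth false s) k (app_t p s) l)|].
Qed.

(** The entries at position [k] form a function on finitely many words, so there are countably many
    choices, and one of them keeps the set of bases from being small. *)
Definition prolong (k : nat) (p : approximation)
    (f : {ffun k.-tuple bool -> bool * nat}) : approximation :=
  Approximation (app_m p) (app_c p)
    (fun s i => if (i < k)%N then app_t p s i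
                else if insub s is Some u then f u else (false, 0%N)).

Lemma bases_prolong k p :
  bases k p `<=` \bigcup_f bases_upto k k.+1 (@prolong k p f).
Proof.
move=> x [x0 xs].
have /ex_choice[y yP] : forall s, exists y, size s = k ->
    T (shift (app_m p) (nth false s) k x) y /\
    agree k (fun i => (shift (app_m p) (nth false s) k x i, y i)) (app_t p s).
  move=> s; have [/xs[y ? ?]|ns] := pselect (size s = k); first by exists y.
  by exists (fun=> 0%N).
exists [ffun u : k.-tuple bool => (shift (app_m p) (nth false u) k x k, y u k)] => //.
split=> // s sk; have [Ts ags] := yP s sk; exists (y s) => // i.
rewrite ltnS leq_eqVlt /= => /predU1P[->|ik]; last by rewrite ik; exact: ags.
have /eqP sk' := sk.
by rewrite ltnn (_ : insub s = Some (Tuple sk')) ?ffunE//; exact: insubT.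
Qed.

Definition next (k : nat) (p : approximation) (m c : nat) : approximation :=
  Approximation (fun i => if (i < k)%N then app_m p i else m)
    (fun i => if (i < k)%N then app_c p i else c)
    (fun s => app_t p (take k s)).

(** For a word of length [k.+1], the last letter chooses between the bases [x] and [flip m x] of
    stage [k]; the flips commute, so the new one may be done first. *)
Lemma bases_next k p m c :
  flip_pairs (bases_upto k k.+1 p) m c `<=` bases k.+1 (next k p m c).
Proof.
move=> x [[x0 xs] [_ xfs] xm xc]; split.
  move=> i; rewrite ltnS leq_eqVlt /= => /predU1P[->|ik]; first by rewrite ltnn.
  by rewrite ik; exact: x0.
move=> s sk; have tk : size (take k s) = k by rewrite size_take sk ltnSn.
have E : shift (app_m (next k p m c)) (nth false s) k.+1 x =
    shift (app_m p) (nth false (take k s)) k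
      (if nth false s k then flip m x else x).
  rewrite /= ltnn -shift_flipr; set b := nth false s k.
  have S y : shift (fun i => if (i < k)%N then app_m p i else m) (nth false s) k y =
      shift (app_m p) (nth false (take k s)) k y.
    by apply: shift_agree => i ik; rewrite ?ik ?nth_take.
  by case: b; rewrite S.
rewrite E; case: (nth false s k); [exact: xfs|exact: xs].
Qed.

Lemma good_step k p : good k p -> exists q, good k.+1 q /\ extends k p q.
Proof.
move=> [mi clev nb].
have [f nf] : exists f, ~ small (bases_upto k k.+1 (@prolong k p f)).
  apply: contrapT => /forallNP h; apply: nb; apply: small_sub (bases_prolong (p := p)) _.
  by apply: small_bigcup => f; apply: contrapT; exact: h.
have [L Lm] := ex_bound (app_m p) k.
have [m [c [Lle clev' nmc]]] :=
  flip_pairs_levels a k L (analytic_bases k k.+1 (prolong p f)) nf.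
exists (next k (@prolong k p f) m c); split; split=> /=.
- move=> i j /andP[ij jk]; move: jk; rewrite ltnS leq_eqVlt.
  move=> /predU1P[jE|jk]; last by rewrite jk (ltn_trans ij)// mi// ij.
  by rewrite jE ltnn -jE ij (leq_trans _ Lle)// Lm// -jE.
- move=> i d; rewrite ltnS leq_eqVlt => /predU1P[->|ik]; last by rewrite ik; exact: clev.
  by rewrite ltnn; exact: clev'.
- by apply: contra_not nmc; apply: small_sub; exact: bases_next.
- by move=> i ->.
- by move=> i ->.
- by move=> s sk i ik; rewrite ik.
Qed.

(** The bases [X k] of different stages are unrelated points. What converges is the prescribed
    segments: [W z] is read off them and agrees up to [k] with the shift of [X k] along [z], so each
    property is checked on a long enough shift. *)
Lemma closed_rel_embedding : exists (W : (nat -> bool) -> (nat -> bool))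
    (Y : (nat -> bool) -> (nat -> nat)) (m c : nat -> nat),
  [/\ forall z, T (W z) (Y z),
      forall k z z', agree k z z' -> agree k (Y z) (Y z'),
      forall z i, W z (m i) = z i,
      forall z i, W (flip i z) = flip (m i) (W z)
    & forall z i, ones (W z) (m i) = (c i + ones z i)%N /\
        forall d, (d <= i)%N -> levels a (c i + d) = levels a d].
Proof.
pose p0 := Approximation (fun=> 0%N) (fun=> 0%N) (fun _ _ => (false, 0%N)).
have [||p [_ pP]] := @dependent_sequence _ good extends p0.
- split=> //; first by move=> i j; rewrite ltn0 andbF.
  apply: contra_not nT; apply: small_sub => x [y Txy]; split=> // s _.
  by exists y.
- exact: good_step.
pose m i := app_m (p i.+1) i; pose c i := app_c (p i.+1) i.
pose t z i := app_t (p i.+1) (mkseq z i.+1) i.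
have mE k : agree k (app_m (p k)) m.
  elim: k => // k IH i; rewrite ltnS leq_eqVlt => /predU1P[->//|ik].
  by have [_ [+ _ _]] := pP k => <-//; exact: IH.
have cE k : agree k (app_c (p k)) c.
  elim: k => // k IH i; rewrite ltnS leq_eqVlt => /predU1P[->//|ik].
  by have [_ [_ + _]] := pP k => <-//; exact: IH.
have tE z k : agree k (app_t (p k) (mkseq z k)) (t z).
  elim: k => // k IH i; rewrite ltnS leq_eqVlt => /predU1P[->//|ik].
  have [_ [_ _ ->]] := pP k; rewrite ?size_mkseq// take_mkseq//; exact: IH.
have mi k : increasing_below k m.
  move=> i j /andP[ij jk]; have [[mi _ _] _] := pP k.
  by rewrite -!(mE k)// ?(ltn_trans ij)// mi// ij.
have /ex_choice[X XP] : forall k, exists x, bases k (p k) x.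
  move=> k; have [[_ _ nb] _] := pP k; apply: contrapT => /forallNP h; apply: nb.
  by apply: small_sub small0 => x /h.
have X0 k i : (i < k)%N -> X k (m i) = false /\ ones (X k) (m i) = c i.
  by move=> ik; have [/(_ i ik)] := XP k; rewrite mE// cE.
pose W z i := (t z i).1; pose Y z i := (t z i).2.
have WP z k : exists2 y, T (shift m z k (X k)) y &
    agree k (shift m z k (X k)) (W z) /\ agree k y (Y z).
  have [_ /(_ (mkseq z k) (size_mkseq _ _))[y Ty ty]] := XP k.
  have sE : shift (app_m (p k)) (nth false (mkseq z k)) k (X k) = shift m z k (X k).
    by apply: shift_agree => //; apply/agree_sym/agree_mkseq.
  rewrite sE in Ty ty; exists y => //.
  by split=> i ik; have := ty i ik; rewrite tE// /W /Y => <-.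
have Wag z k : agree k (W z) (shift m z k (X k)).
  by have [y _ [ag _]] := WP z k; exact: agree_sym.
exists W, Y, m, c; split.
- move=> z; apply: cT => k; have [y Ty [ag ag']] := WP z k.
  by exists (shift m z k (X k)), y; split=> //; apply: agree_sym.
- move=> k z z' zz' i ik; rewrite /Y /t (@mkseq_agree _ _ z z')//.
  exact: agree_le zz'.
- move=> z i; set k := (maxn i (m i)).+1.
  have ik : (i < k)%N by rewrite ltnS leq_maxl.
  rewrite (Wag z k) ?ltnS ?leq_maxr//; apply: shift_at => //.
  by have [] := X0 k i ik.
- move=> z i; apply/funext => j; set k := (maxn i j).+1.
  rewrite (Wag _ k) ?ltnS ?leq_maxr// shift_flipl ?ltnS ?leq_maxl//.
  by rewrite /flip (Wag z k)// ltnS leq_maxr.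
- move=> z i; split.
    set k := (maxn i (m i)).+1.
    have ik : (i < k)%N by rewrite ltnS leq_maxl.
    rewrite (ones_agree (agree_le _ (Wag z k))); last by rewrite ltnW// ltnS leq_maxr.
    rewrite ones_shift//; first by have [_ ->] := X0 k i ik.
    by move=> j /X0[].
  move=> d di; have [[_ lev _] _] := pP i.+1.
  by rewrite -(cE i.+1)//; apply: lev.
Qed.

End Embedding.

Lemma analytic_embedding a T :
  closed_rel T -> ~ small [set x | exists y, T x y] ->
  exists (W : (nat -> bool) -> (nat -> bool)) (Y : (nat -> bool) -> (nat -> nat)),
  [/\ forall z, T (W z) (Y z),
      forall k z z', agree k z z' -> agree k (Y z) (Y z'),
      injective W
    & forall z z', edge a (W z) (W z') <-> edge a z z'].
Proof.
move=> cT nT.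
have [W [Y [m [c [TW Yc Wm Wf Wc]]]]] := closed_rel_embedding a cT nT.
exists W, Y; split=> //.
  by move=> z z' zz'; apply/funext => i; rewrite -(Wm z) -(Wm z') zz'.
move=> z z'; split.
  move=> [n [Wn WE lev]].
  have [i zi] : exists i, z i <> z' i.
    apply: contrapT => /forallNP h; have zz' : z = z'.
      by apply/funext => i; apply: contrapT; exact: h.
    by have := flip_neq_id (n := n) (x := W z); rewrite -WE zz'.
  have min j : z j <> z' j -> m j = n.
    move=> zj; apply: contrapT => /eqP mn; apply: zj.
    by rewrite -(Wm z j) -(Wm z' j) WE flip_neq.
  have zE : z' = flip i z.
    apply/funext => j; have [->|ji] := eqVneq j i.
      by rewrite flip_at; case: (z i) (z' i) zi => [] [].
    rewrite flip_neq//; apply: contrapT => zj.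
    have mij : m i = m j by rewrite !min//; apply: nesym.
    (* With [m i = m j], bits [i] and [j] of every point would be equal, which fails for
       [flip j z]. *)
    have zij : z j = z i by rewrite -(Wm z i) mij Wm.
    have := Wm (flip j z) i; rewrite mij Wm flip_at flip_neq 1?eq_sym// zij.
    by case: (z i).
  exists i; split=> //; first by rewrite -(Wm z i) min.
  have [oE lev'] := Wc z i; move: lev; rewrite -(min i)// oE lev'//; exact: ones_le.
move=> [i [zi -> lev]]; exists (m i); split; rewrite ?Wm ?Wf//.
have [oE lev'] := Wc z i; rewrite oE lev'//; exact: ones_le.
Qed.

(** * Baire category on the Cantor space *)

Definition starts (s : seq bool) (x : nat -> bool) : Prop := mkseq x (size s) = s.

Lemma starts_mkseq x k : starts (mkseq x k) x.
Proof. by rewrite /starts size_mkseq. Qed.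

Lemma startsP s x : starts s x <-> agree (size s) x (nth false s).
Proof.
split=> [sx i i_s|xs].
  by have := congr1 (fun r => nth false r i) sx; rewrite nth_mkseq.
apply: (@eq_from_nth _ false); rewrite size_mkseq// => i i_s.
by rewrite nth_mkseq// xs.
Qed.

Lemma prefix_mkseq (x : nat -> bool) k l : (k <= l)%N -> prefix (mkseq x k) (mkseq x l).
Proof. by move=> kl; rewrite prefixE size_mkseq take_mkseq. Qed.

Lemma prefix_starts s x k : prefix s (mkseq x k) -> starts s x.
Proof.
move=> sk; have ssk := size_prefix sk; rewrite size_mkseq in ssk.
by move: sk; rewrite prefixE take_mkseq// => /eqP.
Qed.

(** Each [D j] stands for a dense open set, the union of the cylinders of its words. *)
Definition dense_family (J : Type) (D : J -> set (seq bool)) : Prop :=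
  forall j s, exists t, D j (s ++ t).

Definition generic (J : Type) (D : J -> set (seq bool)) (x : nat -> bool) : Prop :=
  forall j, exists k, D j (mkseq x k).

Lemma exists_generic (J : countType) (D : J -> set (seq bool)) s :
  dense_family D -> exists x, starts s x /\ generic D x.
Proof.
move=> dD.
have [|n r [sr _]|r [r0 rP]] := @dependent_sequence (seq bool)
  (fun n r => prefix s r /\ (n <= size r)%N)
  (fun n r r' => prefix r r' /\
     if unpickle n is Some j then exists k, D j (take k r') else True) s.
- by rewrite prefix_refl.
- have [r' [rr' Dr']] : exists r', prefix r r' /\
      if unpickle n is Some j then exists k, D j (take k r') else True.
    case: unpickle => [j|]; last by exists r; rewrite prefix_refl.
    have [t Dt] := dD j r; exists (r ++ t); rewrite prefix_prefix; split=> //.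
    by exists (size (r ++ t)); rewrite take_size.
  (* The padding makes the lengths unbounded, so that the words determine a point. *)
  exists (r' ++ nseq n.+1 false); split; first split.
  + by rewrite (prefix_trans (prefix_trans sr rr'))// prefix_prefix.
  + by rewrite size_cat size_nseq leq_addl.
  + split; first by rewrite (prefix_trans rr')// prefix_prefix.
    case: unpickle Dr' => // j [k Dk]; exists (minn k (size r')).
    rewrite takel_cat ?geq_minr//.
    by have [kr|/ltnW rk] := leqP k (size r'); rewrite ?take_size -1?(take_oversize rk).
pose x i := nth false (r i.+1) i.
have rr k l : (k <= l)%N -> prefix (r k) (r l).
  elim: l => [|l IH]; first by rewrite leqn0 => /eqP ->; exact: prefix_refl.
  rewrite leq_eqVlt ltnS => /predU1P[->|/IH kl]; first exact: prefix_refl.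
  by have [_ [+ _]] := rP l; exact: prefix_trans.
have nthr k l i : (k <= l)%N -> (i < size (r k))%N -> nth false (r l) i = nth false (r k) i.
  by move=> /rr; rewrite prefixE => /eqP {2}<- ik; rewrite nth_take.
have xr k : starts (r k) x.
  apply/startsP => i ik; rewrite /x.
  have [ki|ik'] := leqP k i; first by rewrite (nthr k)// ltnW.
  rewrite -(nthr i.+1 k)//; have [[_ +] _] := rP i.+1; exact.
exists x; split; first by rewrite -r0.
move=> j; have [_ [_]] := rP (pickle j); rewrite pickleK => -[k Dk].
exists (minn k (size (r (pickle j).+1))).
suff -> : mkseq x (minn k (size (r (pickle j).+1))) = take k (r (pickle j).+1) by [].
rewrite -{2}(xr (pickle j).+1).
have [ks|/ltnW sk] := leqP k (size (r (pickle j).+1)); first by rewrite take_mkseq.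
by rewrite take_oversize// size_mkseq.
Qed.

Definition comeager_below (s : seq bool) (B : set (nat -> bool)) : Prop :=
  exists2 D : nat -> set (seq bool), dense_family D &
    forall x, starts s x -> generic D x -> B x.

Lemma comeager_belowI (J : countType) (D : J -> set (seq bool)) s B :
  dense_family D -> (forall x, starts s x -> generic D x -> B x) ->
  comeager_below s B.
Proof.
move=> dD DB; exists (fun n => if unpickle n is Some j then D j else setT).
  by move=> n r; case: unpickle => //; exists [::].
by move=> x sx gx; apply: DB => // j; have := gx (pickle j); rewrite pickleK.
Qed.

Lemma comeager_below_bigcap (J : countType) s (B : J -> set (nat -> bool)) :
  (forall j, comeager_below s (B j)) -> comeager_below s (\bigcap_j B j).
Proof.
move=> cB; have /ex_choice[D DP] : forall j, exists D : nat -> set (seq bool),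
    dense_family D /\ forall x, starts s x -> generic D x -> B j x.
  by move=> j; have [D ? ?] := cB j; exists D.
apply: (@comeager_belowI (J * nat)%type (fun p => D p.1 p.2)).
  by move=> [j n]; exact: (DP j).1.
by move=> x sx gx j _; apply: (DP j).2 => // n; exact: (gx (j, n)).
Qed.

Lemma comeager_below_sub s B C : B `<=` C -> comeager_below s B -> comeager_below s C.
Proof. by move=> BC [D dD DB]; exists D => // x sx gx; apply/BC/DB. Qed.

Lemma comeager_below_local s B :
  (forall t, exists t', comeager_below (s ++ t ++ t') B) -> comeager_below s B.
Proof.
move=> h.
have /ex_choice[D DP] : forall t, exists D : nat -> set (seq bool), dense_family D /\
    (comeager_below t B -> forall x, starts t x -> generic D x -> B x).
  move=> t; have [[D ? ?]|nt] := pselect (comeager_below t B); first by exists D.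
  by exists (fun=> setT); split=> // n r; exists [::].
apply: (@comeager_belowI (option (seq bool * nat)) (fun o => if o is Some (t, n)
  then D t n else [set r | (exists t, prefix t r /\ comeager_below t B) \/
                           ~~ (prefix r s || prefix s r)])).
  move=> [[t n]|] r; first exact: (DP t).1.
  have [/prefixP[u sE]|rs] := boolP (prefix r s).
    have [t' ct'] := h [::]; exists (u ++ t'); left; exists (s ++ t').
    by rewrite sE catA prefix_refl -sE.
  have [/prefixP[u ->]|sr] := boolP (prefix s r).
    have [t' ct'] := h u; exists t'; left; exists (s ++ u ++ t').
    by rewrite catA prefix_refl -catA.
  by exists [::]; rewrite cats0; right; rewrite negb_or rs.
move=> x sx gx; have [k [[t [tx ct]]|]] := gx None.
  apply: (DP t).2 => //; first exact: prefix_starts tx.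
  by move=> n; exact: (gx (Some (t, n))).
rewrite -{1 2}sx => /negP[]; apply/orP.
by have [ks|/ltnW sk] := leqP k (size s); [left|right]; exact: prefix_mkseq.
Qed.

Definition decided (B : set (nat -> bool)) : Prop :=
  forall s, exists t, comeager_below (s ++ t) B \/ comeager_below (s ++ t) (~` B).

(** The Baire property. For a union, either some [B n] is comeager below an extension of [s], or
    every complement is comeager below densely many extensions, hence below [s]. *)
Lemma bor_decided B : bor B -> decided B.
Proof.
elim=> [n|{}B _ IH|{}B _ IH] s.
- exists (nseq n.+1 false).
  have xn x : starts (s ++ nseq n.+1 false) x ->
      x n = nth false (s ++ nseq n.+1 false) n.
    by move/startsP; apply; rewrite size_cat size_nseq addnS ltnS leq_addl.
  have dT : dense_family (fun _ : nat => @setT (seq bool)) by move=> ? ?; exists [::].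
  case E: (nth false (s ++ nseq n.+1 false) n); [left|right]; exists (fun=> setT) => //.
    by move=> x /xn; rewrite E /bit.
  by move=> x /xn; rewrite E /setC/bit/= => ->.
- by have [t []] := IH s; exists t; [right; rewrite setCK|left].
- have [[n [t cB]]|nB] := pselect (exists n t, comeager_below (s ++ t) (B n)).
    by exists t; left; apply: comeager_below_sub cB => x Bx; exists n.
  exists [::]; right; rewrite cats0 setC_bigcup; apply: comeager_below_bigcap => n.
  apply: comeager_below_local => t; have [t' []] := IH n (s ++ t); rewrite -catA => cB.
    by case: nB; exists n, (t ++ t').
  by exists t'.
Qed.

Lemma foldr_flip_flip n x l : foldr flip (flip n x) l = flip n (foldr flip x l).
Proof. by elim: l => //= m l ->; rewrite flipC. Qed.

Lemma foldr_flipK x l : foldr flip (foldr flip x l) l = x.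
Proof. by elim: l => //= m l IH; rewrite foldr_flip_flip flipK. Qed.

Lemma agree_foldr_flip k x y l : agree k x y ->
  agree k (foldr flip x l) (foldr flip y l).
Proof. by move=> xy; elim: l => //= m l; exact: agree_flip2. Qed.

(** [G] consists of the points all of whose finite modifications are generic for the words deciding
    each [B j] and for the dense sets witnessing these decisions. An initial segment thus settles
    membership in [B j] for all points of [G] extending it. *)
Lemma bor_generic (J : countType) (B : J -> set (nat -> bool)) :
  (forall j, bor (B j)) -> exists G : set (nat -> bool),
  [/\ forall s, exists x, starts s x /\ G x,
      forall n x, G x -> G (flip n x)
    & forall x j, G x -> exists k, forall y, G y -> agree k x y -> (B j x <-> B j y)].
Proof.
move=> bB.
have /ex_choice[D DP] : forall p : seq bool * J, exists D : nat -> set (seq bool),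
    dense_family D /\
    (comeager_below p.1 (B p.2) \/ comeager_below p.1 (~` B p.2) ->
     (forall x, starts p.1 x -> generic D x -> B p.2 x) \/
     (forall x, starts p.1 x -> generic D x -> ~ B p.2 x)).
  move=> [t j] /=.
  have [[[D dD DB]|[D dD DB]]|nB] :=
      pselect (comeager_below t (B j) \/ comeager_below t (~` B j)).
  - by exists D; split=> // _; left.
  - by exists D; split=> // _; right.
  - by exists (fun=> setT); split=> // ? ?; exists [::].
pose E (o : J + (seq bool * J * nat)) := match o with
  | inl j => [set t | comeager_below t (B j) \/ comeager_below t (~` B j)]
  | inr (p, n) => D p n end.
have dE : dense_family E.
  by move=> [j s|[p n]]; [exact: bor_decided|exact: (DP p).1].
exists [set x | forall l, generic E (foldr flip x l)]; split.
- move=> s.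
  (* Genericity of the modification along [l] is a dense condition on [x] itself: flip the word,
     extend it into [E o], and flip back. *)
  have [|x [sx gx]] := @exists_generic _ (fun p : seq nat * _ =>
    [set r | E p.2 (mkseq (foldr flip (nth false r) p.1) (size r))]) s.
    move=> [l o] r /=; set q := mkseq (foldr flip (nth false r) l) (size r).
    have [t Et] := dE o q.
    pose y := foldr flip (nth false (q ++ t)) l.
    have yr : starts r y.
      apply/startsP => i ir; rewrite /y -[in RHS](foldr_flipK (nth false r) l).
      apply: (agree_foldr_flip (k := size r)) => // j jr.
      by rewrite nth_cat size_mkseq jr nth_mkseq.
    exists (drop (size r) (mkseq y (size (q ++ t)))).
    have rq : (size r <= size (q ++ t))%N by rewrite size_cat size_mkseq leq_addr.
    have -> : r ++ drop (size r) (mkseq y (size (q ++ t))) = mkseq y (size (q ++ t)).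
      by rewrite -[RHS](cat_take_drop (size r)) take_mkseq// yr.
    rewrite size_mkseq.
    rewrite (_ : mkseq _ _ = q ++ t)//; apply: (@eq_from_nth _ false).
      by rewrite size_mkseq.
    rewrite size_mkseq => i iq; rewrite nth_mkseq//.
    rewrite -[in RHS](foldr_flipK (nth false (q ++ t)) l).
    by apply: (agree_foldr_flip (k := size (q ++ t))) => // j jq; rewrite nth_mkseq.
  exists x; split=> // l o; have [k] := gx (l, o); rewrite /= size_mkseq => Ek.
  exists k; rewrite (@mkseq_agree _ _ _ (foldr flip (nth false (mkseq x k)) l))//.
  exact/agree_foldr_flip/agree_mkseq.
- by move=> n x Gx l; have := Gx (rcons l n); rewrite foldr_rcons.
- move=> x j Gx; have [k Ek] := Gx [::] (inl j); exists k => y Gy xy.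
  have gD z : (forall l, generic E (foldr flip z l)) -> generic (D (mkseq x k, j)) z.
    by move=> Gz n; exact: (Gz [::] (inr (mkseq x k, j, n))).
  have sy : starts (mkseq x k) y by rewrite (mkseq_agree xy); exact: starts_mkseq.
  have sx := starts_mkseq x k.
  have [BD|BD] := (DP (mkseq x k, j)).2 Ek; split=> //.
  + by move=> _; apply: BD => //; exact: gD.
  + by move=> _; apply: BD => //; exact: gD.
  + by move/(BD x sx (gD x Gx)).
  + by move/(BD y sy (gD y Gy)).
Qed.

(** Inside [G] the bits from [k] on can be set one at a time. Enough ones bring their number to a
    level, found by recurrence of the letter at 0, and a zero is placed next. *)
Lemma flip_invariant_edge a (G : set (nat -> bool)) x k :
  (forall n x, G x -> G (flip n x)) -> G x ->
  exists z n, [/\ G z, agree k x z, (k <= n)%N, z n = false & levels a (ones z n)].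
Proof.
move=> Gf Gx.
have set_bit b n z : G z -> exists z', [/\ G z', agree n z z' & z' n = b].
  move=> Gz; have [zn|zn] := eqVneq (z n) b; first by exists z.
  exists (flip n z); split; [exact: Gf|exact/agree_sym/agree_flip|].
  by rewrite flip_at; case: (z n) b zn => [] [].
have [N NP] := levels_recurrent a 0.
have [j _ /(_ 0%N (leqnn 0))] := NP (ones x k); rewrite addn0 => lev.
have [z [Gz xz oz]] : exists z, [/\ G z, agree k x z & ones z (k + j) = (ones x k + j)%N].
  elim: j {lev} => [|j [z [Gz xz oz]]]; first by exists x; rewrite !addn0.
  have [z' [Gz' zz' z'1]] := set_bit true (k + j)%N z Gz; exists z'; split=> //.
    by apply: agree_trans xz _; apply: agree_le zz'; exact: leq_addr.
  by rewrite !addnS onesS z'1 -(ones_agree zz') oz addn1.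
have [z' [Gz' zz' z'0]] := set_bit false (k + j)%N z Gz.
exists z', (k + j)%N; split=> //; rewrite ?leq_addr//.
  by apply: agree_trans xz _; apply: agree_le zz'; exact: leq_addr.
by rewrite -(ones_agree zz') oz lev.
Qed.

Lemma bor_cover_edge (J : countType) a (B : J -> set (nat -> bool)) :
  (forall j, bor (B j)) -> (forall x, exists j, B j x) ->
  exists j x y, [/\ B j x, B j y & edge a x y].
Proof.
move=> bB cB; have [G [Gne Gf Gc]] := bor_generic bB.
have [x [_ Gx]] := Gne [::]; have [j Bx] := cB x.
have [k kP] := Gc x j Gx.
have [z [n [Gz xz kn zn lev]]] := flip_invariant_edge a k Gf Gx.
exists j, z, (flip n z); split; [exact/(kP z)| |by exists n].
apply/(kP (flip n z)) => //; first exact: Gf.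
by apply: agree_trans xz _; exact/agree_sym/agree_flip.
Qed.

(** * The relations and their reductions *)

Definition arc (a : nat -> bool) (p q : (nat -> bool) * bool) : Prop :=
  [/\ p.2 = false, q.2 = true & edge a p.1 q.1].

(** Arcs lead from copy 0 to copy 1, so no two of them compose. Without symmetrization the relation
    is therefore antisymmetric and transitive, and the two flags serve all seven classes. *)
Definition rel_of (sym refl : bool) (a : nat -> bool) (p q : (nat -> bool) * bool) : Prop :=
  [\/ arc a p q, sym /\ arc a q p | refl /\ p = q].

(* The pairs outside [rel_of sym refl a] which are limits of it. *)
Definition limit_of (sym : bool) (p q : (nat -> bool) * bool) : Prop :=
  [/\ p.1 = q.1, q.2 = ~~ p.2 & sym || ~~ p.2].

Definition pagree (k : nat) (p q : (nat -> bool) * bool) : Prop :=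
  agree k p.1 q.1 /\ p.2 = q.2.

Lemma edge_irrefl a x : ~ edge a x x.
Proof. by move=> [n [_ xx _]]; apply: (@flip_neq_id n x). Qed.

(** A coordinate where [x] and [y] differ must be the flipped coordinate of every close enough edge,
    so it does not escape to infinity. *)
Lemma edge_closed a x y : x <> y ->
  (forall k, exists x' y', [/\ agree k x x', agree k y y' & edge a x' y' \/ x' = y']) ->
  edge a x y.
Proof.
move=> xy app.
have [i xyi] : exists i, x i <> y i.
  apply: contrapT => /forallNP h; apply: xy; apply/funext => i.
  by apply: contrapT; exact: h.
have appi k : (i < k)%N -> exists x' y', [/\ agree k x x', agree k y y',
    x' i = false, y' = flip i x' & levels a (ones x' i)].
  move=> ik; have [x' [y' [xx' yy' [[n [xn yE lev]]|xy']]]] := app k; last first.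
    by case: xyi; rewrite xx'// yy'// xy'.
  have ni : n = i.
    apply: contrapT => ni; apply: xyi; rewrite xx'// yy'// yE flip_neq//.
    by rewrite eq_sym; apply/eqP.
  by exists x', y'; rewrite -ni.
exists i; have [x' [y' [xx' yy' x'i yE lev]]] := appi i.+1 (ltnSn i).
split; first by rewrite xx'.
  apply/funext => j; have [|u [v [xu yv ui vE _]]] := appi (maxn i j).+1.
    by rewrite ltnS leq_maxl.
  by rewrite yv ?ltnS ?leq_maxr// vE /flip xu// ltnS leq_maxr.
by rewrite (ones_agree (agree_le _ xx')).
Qed.

(** Arcs can leave the relation in the limit only when both ends tend to the same point, and this
    yields the pairs of [limit_of]. *)
Lemma rel_of_closed sym refl a p q :
  (forall k, exists p' q', [/\ pagree k p p', pagree k q q' &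
     rel_of sym refl a p' q' \/ limit_of sym p' q']) ->
  rel_of sym refl a p q \/ limit_of sym p q.
Proof.
case: p q => [x e] [y d] app.
have {}app k : exists x' y', [/\ agree k x x', agree k y y' &
    rel_of sym refl a (x', e) (y', d) \/ limit_of sym (x', e) (y', d)].
  by have [[x' e'] [[y' d'] [[/= xx' ->] [/= yy' ->] h]]] := app k; exists x', y'.
have same : e = d -> rel_of sym refl a (x, e) (y, d).
  move=> de; have eq_near k : refl /\ agree k x y.
    have [x' [y' [xx' yy']]] := app k; rewrite -de.
    case=> [[[/= -> //]|[_ [/= -> //]]|[rf [xy']]]|[_ /=]]; last by case: (e).
    by split=> // i ik; rewrite xx'// yy'// xy'.
  rewrite de; apply: Or33; split; first by have [] := eq_near 0%N.
  by congr pair; apply/funext => i; have [_ ->] := eq_near i.+1.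
case: e d app same => [] [] app same; try by left; exact: same.
- have appe k : exists x' y',
      [/\ agree k y y', agree k x x', edge a y' x' \/ y' = x' & sym].
    have [x' [y' [xx' yy']]] := app k.
    case=> [[[]//|[sy [_ _ /= ed]]|[_ //]]|[/= xy _ sy]]; exists x', y'; split=> //.
    - by left.
    - by right.
    - by case: (sym) sy.
  have sy : sym by have [? [? []]] := appe 0%N.
  have [xy|xy] := pselect (y = x); first by right; split=> //=; rewrite sy.
  left; apply: Or32; split=> //; split=> //=; apply: edge_closed => // k.
  by have [x' [y' [yy' xx' ed _]]] := appe k; exists y', x'.
- have [xy|xy] := pselect (x = y); first by right; split=> //=; rewrite orbT.
  left; apply: Or31; split=> //=; apply: edge_closed => // k.
  have [x' [y' [xx' yy' h]]] := app k; exists x', y'; split=> //.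
  by case: h => [[[_ _ /= ed]|[_ [//]]|[_ //]]|[/= xy' _ _]]; [left|right].
Qed.

Lemma rel_of_limit_disjoint sym refl a p q :
  rel_of sym refl a p q -> ~ limit_of sym p q.
Proof.
move=> r [pq1 pq2 _]; case: r => [[_ _ ed]|[_ [_ _ ed]]|[_ pq]].
- by rewrite pq1 in ed; exact: edge_irrefl ed.
- by rewrite pq1 in ed; exact: edge_irrefl ed.
- by move: pq2; rewrite pq; case: (q.2).
Qed.

Lemma rel_of_levels sym refl a x y :
  rel_of sym refl a (x, false) (y, true) <-> edge a x y.
Proof.
split=> [[[]//|[_ []//]|[_ //]]|ed]; exact: Or31.
Qed.

(** * Incomparability of the relations *)

Section Antichain.
Variables (sym refl : bool) (a b : nat -> bool).
Variable u : (nat -> bool) * bool -> (nat -> bool) * bool.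
Hypothesis uE : forall p q, rel_of sym refl a p q <-> rel_of sym refl b (u p) (u q).
Variable G : set (nat -> bool).
Hypothesis Gf : forall n x, G x -> G (flip n x).
Hypothesis Gc : forall x k, G x -> exists l, forall y, G y -> agree l x y ->
  forall e, pagree k (u (x, e)) (u (y, e)).

(** The two copies of [x] are unrelated but are limits of arcs with ends over [G]; by continuity on
    [G] their images have the same property. *)
Lemma limit_reduction x : G x -> limit_of sym (u (x, false)) (u (x, true)).
Proof.
move=> Gx.
have [] := @rel_of_closed sym refl b (u (x, false)) (u (x, true)) => //; last first.
  by move/uE/rel_of_levels/edge_irrefl.
move=> k; have [l lP] := Gc k Gx.
have [z [n [Gz xz ln zn lev]]] := flip_invariant_edge a l Gf Gx.
exists (u (z, false)), (u (flip n z, true)); split; [exact: lP| |].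
  by apply: lP; [exact: Gf|apply: agree_trans xz _; exact/agree_sym/agree_flip].
by left; apply/uE/rel_of_levels; exists n.
Qed.

Variable x0 : nat -> bool.
Hypothesis Gx0 : G x0.

(** When [e] is true, the reduction exchanges the copies and reverses arcs near [x0], which requires
    symmetry; this is where reflected windows come from. *)
Let e := (u (x0, false)).2.
Let w (x : nat -> bool) := (u (x, false)).1.

Lemma reduction_levels : exists k0, forall x, G x -> agree k0 x0 x ->
  [/\ u (x, false) = (w x, e), u (x, true) = (w x, ~~ e) & sym || ~~ e].
Proof.
have [k0 kP] := Gc 0 Gx0; exists k0 => x Gx xx0.
have [w2 e2 s2] := limit_reduction Gx.
have eE : (u (x, false)).2 = e by have [_ h] := kP x Gx xx0 false; rewrite -h.
move: s2; rewrite eE => s2; split=> //; first by rewrite /w -eE -surjective_pairing.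
by rewrite (surjective_pairing (u (x, true))) e2 -w2 eE.
Qed.

(** Used when [z n] is false: the bit condition says that the image of the edge points forwards or
    backwards according to [e]. *)
Definition tracks n m z : Prop := w (flip n z) = flip m (w z) /\ w z m = e.

Section Levels.
Variable k0 : nat.
Hypothesis k0P : forall x, G x -> agree k0 x0 x ->
  [/\ u (x, false) = (w x, e), u (x, true) = (w x, ~~ e) & sym || ~~ e].

Lemma edge_reduction x y : G x -> agree k0 x0 x -> G y -> agree k0 x0 y ->
  edge a x y <-> if e then edge b (w y) (w x) else edge b (w x) (w y).
Proof.
move=> Gx xx0 Gy yx0; have [ux _ se] := k0P Gx xx0; have [_ uy _] := k0P Gy yx0.
rewrite -(rel_of_levels sym refl) uE ux uy.
case: e se => /= se; last exact: rel_of_levels.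
rewrite orbF in se; split=> [[[]//|[_ [_ _ ed]]//|[_ //]]|ed].
by apply: Or32; split.
Qed.

Lemma tracks_edge n z : G z -> agree k0 x0 z -> (k0 <= n)%N ->
  z n = false -> levels a (ones z n) -> exists m, tracks n m z.
Proof.
move=> Gz zx0 kn zn lev.
have fx0 : agree k0 x0 (flip n z).
  by apply: agree_trans zx0 _; exact/agree_sym/agree_flip.
have : edge a z (flip n z) by exists n.
rewrite (edge_reduction Gz zx0 (Gf n Gz) fx0) /tracks.
case: e => -[m [wm wE _]]; exists m; last by [].
by rewrite wE flipK flip_at wm.
Qed.

Lemma tracks_levels n m z : G z -> agree k0 x0 z -> (k0 <= n)%N ->
  z n = false -> tracks n m z -> levels a (ones z n) = levels b (ones (w z) m).
Proof.
move=> Gz zx0 kn zn [wE wm].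
have fx0 : agree k0 x0 (flip n z).
  by apply: agree_trans zx0 _; exact/agree_sym/agree_flip.
have onE : ones (flip m (w z)) m = ones (w z) m by exact: ones_flip_ge.
have := edge_reduction Gz zx0 (Gf n Gz) fx0; rewrite wE => E.
apply/idP/idP => lev.
  have /E : edge a z (flip n z) by exists n.
  move: wm; case: e => wm [m' [_ fE lev']].
    have mm : m' = m by apply: (flip_inj_index (x := flip m (w z))); rewrite -fE flipK.
    by rewrite mm onE in lev'.
  by rewrite (flip_inj_index fE).
suff /E [n' [_ fE lev']] : if e then edge b (flip m (w z)) (w z)
    else edge b (w z) (flip m (w z)) by rewrite (flip_inj_index fE).
move: wm; case: e => wm; exists m; rewrite ?flip_at ?wm ?flipK ?onE//.
Qed.

(** An allowed edge far out has its image flip far out, because by continuity the images of both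
    ends agree on the first [M] coordinates. *)
Lemma tracks_near x L M : G x -> agree k0 x0 x -> (k0 <= L)%N ->
  exists z n m, [/\ G z, agree L x z, (L <= n)%N /\ (M <= m)%N,
    z n = false /\ levels a (ones z n) & tracks n m z].
Proof.
move=> Gx xx0 kL; have [l lP] := Gc M Gx.
have [z [n [Gz xz ln zn lev]]] := flip_invariant_edge a (maxn l L) Gf Gx.
have lLn : (l <= n)%N /\ (L <= n)%N by move: ln; rewrite geq_max => /andP[].
have xzL : agree L x z by apply: agree_le xz; rewrite leq_maxr.
have xzl : agree l x z by apply: agree_le xz; rewrite leq_maxl.
have zx0 : agree k0 x0 z by apply: agree_trans xx0 _; exact: agree_le xzL.
have [m tm] := tracks_edge Gz zx0 (leq_trans kL lLn.2) zn lev.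
exists z, n, m; split=> //; split; first exact: lLn.2.
rewrite leqNgt; apply/negP => mM; have [wE _] := tm.
have [w1 _] := lP z Gz xzl false.
have [|w2 _] := lP _ (Gf n Gz) _ false.
  by apply: agree_trans xzl _; apply/agree_sym/agree_flip; exact: lLn.1.
have : w z m = w (flip n z) m by rewrite /w -w1// -w2.
by rewrite wE flip_at; case: (w z m).
Qed.

(** Each induction step flips an earlier zero [n0 < n] whose image flip is at [m0 < m]. This adds a
    one before [n], and adds or removes one before [m] according to [e]. Only the first point of the
    chain is chosen on an allowed edge. *)
Lemma tracks_chain k x L M : G x -> agree k0 x0 x -> (k0 <= L)%N ->
  exists n m T T', [/\ (L <= n)%N, (M <= m)%N & forall j, (j <= k)%N ->
    exists z, [/\ G z, agree L x z, z n = false & tracks n m z] /\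
      ones z n = (T + j)%N /\
      if e then (ones (w z) m + j)%N = T' else ones (w z) m = (T' + j)%N].
Proof.
elim: k x L M => [|k IH] x L M Gx xx0 kL.
  have [z [n [m [Gz xz [Ln Mm] [zn lev] tm]]]] := tracks_near M Gx xx0 kL.
  exists n, m, (ones z n), (ones (w z) m); split=> // j; rewrite leqn0 => /eqP ->.
  by exists z; split=> //; rewrite !addn0; split=> //; case: e.
have [z0 [n0 [m0 [Gz0 xz0 [Ln0 Mm0] [zn0 lev0] [wE0 wm0]]]]] := tracks_near M Gx xx0 kL.
have z0x0 : agree k0 x0 z0 by apply: agree_trans xx0 _; exact: agree_le xz0.
have [l lP] := Gc m0.+1 Gz0; have [l' lP'] := Gc m0.+1 (Gf n0 Gz0).
pose L' := maxn (maxn n0.+1 L) (maxn l l').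
have [n0L' LL'] : (n0 < L')%N /\ (L <= L')%N.
  by split; rewrite /L' !leq_max leqnn ?orbT.
have [lL' lL''] : (l <= L')%N /\ (l' <= L')%N.
  by split; rewrite /L' !leq_max leqnn ?orbT.
(* By continuity the images of both ends keep their bits up to [m0], hence the image flip stays at
   [m0] throughout a neighbourhood of [z0]. *)
have near0 y : G y -> agree L' z0 y -> [/\ y n0 = false & tracks n0 m0 y].
  move=> Gy zy.
  have yx0 : agree k0 x0 y.
    by apply: agree_trans z0x0 _; apply: agree_le zy; exact: leq_trans LL'.
  have yn0 : y n0 = false by rewrite -zy.
  have levy : levels a (ones y n0).
    by rewrite -(ones_agree (agree_le _ zy))// ltnW.
  have [m [wE wm]] := tracks_edge Gy yx0 (leq_trans kL Ln0) yn0 levy.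
  have [w1 _] := lP y Gy (agree_le lL' zy) false.
  have [|w2 _] := lP' _ (Gf n0 Gy) _ false.
    by apply: agree_flip2; exact: agree_le zy.
  have w1' : w z0 m0 = w y m0 by exact: w1.
  have w2' : w (flip n0 z0) m0 = w (flip n0 y) m0 by exact: w2.
  suff mm0 : m0 = m by split=> //; rewrite mm0.
  apply/eqP; move: w2'; rewrite wE0 wE flip_at w1' /flip.
  by case: eqVneq => // _; case: (w y m0).
have [|n [m [T [T' [L'n M'm zP]]]]] := IH z0 L' (maxn M m0.+1) Gz0 z0x0.
  exact: leq_trans LL'.
have [Mm m0m] : (M <= m)%N /\ (m0 < m)%N.
  by move: M'm; rewrite geq_max => /andP[].
have n0n : (n0 < n)%N by exact: leq_trans L'n.
exists n, m, T, T'; split=> //; first exact: leq_trans L'n.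
move=> j; rewrite leq_eqVlt ltnS => /predU1P[->|/zP[z [[Gz zz zn tz] oz]]]; last first.
  exists z; split=> //; split=> //; apply: agree_trans xz0 _; exact: agree_le zz.
have [z [[Gz zz zn [wE wm]] [oz ow]]] := zP k (leqnn k).
have [zn0' [wEz wmz]] := near0 z Gz zz.
(* [flip n z] is also near [z0], so its flip at [n0] is carried to [m0] too; commuting the flips
   shows that [flip n0 z] is tracked at [n] by the same [m]. *)
have fzz : agree L' z0 (flip n z).
  by apply: agree_trans zz _; exact/agree_sym/agree_flip.
have [_ [wEf wmf]] := near0 _ (Gf n Gz) fzz.
exists (flip n0 z); split; first split.
- exact: Gf.
- apply: agree_trans xz0 _; apply: agree_trans (agree_le LL' zz) _.
  exact/agree_sym/agree_flip.
- by rewrite flip_neq// gtn_eqF.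
- split; last by rewrite wEz flip_neq// gtn_eqF.
  by rewrite flipC wEf wE wEz flipC.
split; first by have := ones_flip_lt z n0n; rewrite zn0' oz addn0 addn1 addnS.
rewrite wEz; have := ones_flip_lt (w z) m0m; rewrite wmz.
case: e ow => /= ow; rewrite ?addn0 ?addn1; first by move=> h; rewrite addnS -addSn h.
by move=> ->; rewrite ow addnS.
Qed.

End Levels.

Lemma reduction_eq : a = b.
Proof.
have [k0 k0P] := reduction_levels.
apply: levels_window => k.
have [//|n [m [T [T' [kn _ zP]]]]] := tracks_chain k0P k 0 Gx0 _ (leqnn k0).
(* The window is reflected or translated according to [e]; in the first case [k <= T'] keeps the
   truncated subtraction exact. *)
exists T, (fun j => if e then (T' - j)%N else (T' + j)%N).
have T'k : e -> (k <= T')%N.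
  by move=> eT; have [z [_ [_ +]]] := zP k (leqnn k); rewrite eT => <-; rewrite leq_addl.
split.
  move=> i j ik jk; case: e T'k => [/(_ isT) kT|_]; last by rewrite distnDl.
  by move: (leq_trans ik kT) (leq_trans jk kT) => {zP}; clear; lia.
move=> j jk; have [z [[Gz zz zn tz] [oz ow]]] := zP j jk.
rewrite -oz (tracks_levels k0P Gz _ kn zn tz)//; congr levels.
by case: e ow => // <-; rewrite addnK.
Qed.

End Antichain.

(** * Codes of Polish spaces in the Baire space *)

Lemma ex_least (P : nat -> Prop) : (exists n, P n) ->
  exists n, P n /\ forall m, (m < n)%N -> ~ P m.
Proof.
move=> [n Pn]; have ex : exists n, `[< P n >] by exists n; apply/asboolP.
case: (ex_minnP ex) => m /asboolP Pm mP; exists m; split=> // k km Pk.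
by have := mP k (asboolT Pk); rewrite leqNgt km.
Qed.

(* A bijection of [X] with a closed subset of the Baire space. *)
Definition code (X : Type) (h : X -> nat -> nat) : Prop :=
  injective h /\ forall y, (forall k, exists x, agree k (h x) y) -> exists x, h x = y.

Definition open_for (X : Type) (h : X -> nat -> nat) (U : set X) : Prop :=
  forall x, U x -> exists k, forall x', agree k (h x) (h x') -> U x'.

Definition refines (X : Type) (h h' : X -> nat -> nat) : Prop :=
  exists f, forall x i, h x i = h' x (f i).

(** Membership is read off one coordinate, so [B] is clopen in the topology given by [h]. *)
Definition coded (X : Type) (h : X -> nat -> nat) (B : set X) : Prop :=
  exists i (N : set nat), forall x, B x <-> N (h x i).

Lemma refines_refl X (h : X -> nat -> nat) : refines h h.
Proof. by exists id. Qed.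

Lemma refines_trans X (h1 h2 h3 : X -> nat -> nat) :
  refines h1 h2 -> refines h2 h3 -> refines h1 h3.
Proof. by move=> [f fP] [g gP]; exists (g \o f) => x i; rewrite fP gP. Qed.

Lemma refines_coded X (h h' : X -> nat -> nat) B :
  refines h h' -> coded h B -> coded h' B.
Proof. by move=> [f fP] [i [N BN]]; exists (f i), N => x; rewrite BN fP. Qed.

Lemma refines_agree X (h h' : X -> nat -> nat) k : refines h h' ->
  exists l, forall x x', agree l (h' x) (h' x') -> agree k (h x) (h x').
Proof.
move=> [f fP]; have [l lP] := ex_bound f k; exists l => x x' xx' i ik.
by rewrite !fP xx'// lP.
Qed.

Lemma refines_open_for X (h h' : X -> nat -> nat) U :
  refines h h' -> open_for h U -> open_for h' U.
Proof.
move=> hh' hU x /hU[k kP]; have [l lP] := refines_agree k hh'.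
by exists l => x' /lP; exact: kP.
Qed.

Lemma coded_open X (h : X -> nat -> nat) B : coded h B -> open_for h B.
Proof.
move=> [i [N BN]] x /BN Nx; exists i.+1 => x' xx'; apply/BN.
by rewrite -xx'.
Qed.

Lemma coded_setC X (h : X -> nat -> nat) B : coded h B -> coded h (~` B).
Proof. by move=> [i [N BN]]; exists i, (~` N) => x; split; apply: contra_not; rewrite BN. Qed.

(** A limit of joined codes gives one point for each [h' n]; all these points have the same code
    under the common coarser [h], so they are equal. *)
Lemma code_join X (h : X -> nat -> nat) (h' : nat -> X -> nat -> nat) :
  code h -> (forall n, code (h' n) /\ refines h (h' n)) ->
  exists g, code g /\ forall n, refines (h' n) g.
Proof.
move=> [hinj _] h'P.
pose g x p := if unpickle p is Some (n, i) then h' n x i else 0%N.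
have gE x n i : g x (pickle (n, i)) = h' n x i by rewrite /g pickleK.
exists g; split; last by move=> n; exists (fun i => pickle (n, i)).
split.
  move=> x x' gxx'; apply: (h'P 0%N).1.1; apply/funext => i.
  by rewrite -!gE gxx'.
move=> y yP.
have /ex_choice[x xP] : forall n, exists x, h' n x = fun i => y (pickle (n, i)).
  move=> n; apply: (h'P n).1.2 => k.
  have [l lP] := ex_bound (fun i => pickle (n, i)) k.
  by have [x xP] := yP l; exists x => i /lP il; rewrite -gE xP.
have xE n : x n = x 0%N.
  apply: hinj; apply/funext => i.
  have [f fP] := (h'P n).2; have [f0 f0P] := (h'P 0%N).2.
  rewrite fP f0P !xP.
  have [z zP] := yP (maxn (pickle (n, f i)) (pickle (0%N, f0 i))).+1.
  by rewrite -!zP ?ltnS ?leq_maxl ?leq_maxr// !gE -fP -f0P.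
exists (x 0%N); apply/funext => p; rewrite /g.
case E : (unpickle p) => [[n i]|].
  have [z zP] := yP (maxn p (pickle (n, i))).+1.
  rewrite -(xE n) xP -!zP ?ltnS ?leq_maxl ?leq_maxr//.
  by rewrite gE /g E.
have [z zP] := yP p.+1.
by rewrite -zP// /g E.
Qed.

(** The hypothesis says that the graph of [g] is closed, so the extended code still has closed
    range. *)
Lemma code_cons X (h : X -> nat -> nat) (g : X -> nat) :
  code h -> (forall c, open_for h [set x | g x <> c]) ->
  code (fun x i => if i is i'.+1 then h x i' else g x).
Proof.
move=> [hinj hr] gc; split.
  move=> x x' xx'; apply: hinj; apply/funext => i.
  by have := congr1 (fun f => f i.+1) xx'.
move=> y yP; have [x xP] : exists x, h x = fun i => y i.+1.
  by apply: hr => k; have [x xP] := yP k.+1; exists x => i ik; exact: (xP i.+1).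
exists x; apply/funext => -[|i]; last by rewrite xP.
apply: contrapT => /gc[k kP]; have [z zP] := yP k.+1.
by apply: (kP z); [move=> i ik; rewrite xP -(zP i.+1)|exact: (zP 0%N)].
Qed.

Definition codable (X : Type) (h : X -> nat -> nat) (B : set X) : Prop :=
  exists h', [/\ code h', refines h h' & coded h' B].

Lemma coded_codable X (h : X -> nat -> nat) B : code h -> coded h B -> codable h B.
Proof. by move=> ch hB; exists h; split=> //; exact: refines_refl. Qed.

Lemma codable_setC X (h : X -> nat -> nat) B : codable h B -> codable h (~` B).
Proof. by move=> [h' [? ? ?]]; exists h'; split=> //; exact: coded_setC. Qed.

Lemma codable_family X (h : X -> nat -> nat) (J : countType) (B : J -> set X) :
  code h -> (forall j, codable h (B j)) ->
  exists h', [/\ code h', refines h h' & forall j, coded h' (B j)].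
Proof.
move=> ch cB.
have /ex_choice[h' h'P] : forall n, exists h', [/\ code h', refines h h' &
    if unpickle n is Some j then coded h' (B j) else True].
  move=> n; case: unpickle => [j|]; last by exists h; split=> //; exact: refines_refl.
  by have [h' ?] := cB j; exists h'.
have [||g [cg gP]] := @code_join _ h h' => //.
  by move=> n; have [] := h'P n.
exists g; split=> //.
  by apply: refines_trans (gP 0%N); have [] := h'P 0%N.
by move=> j; have [_ _] := h'P (pickle j); rewrite pickleK; exact: refines_coded.
Qed.

(* The least index of a set containing the point is added as a coordinate. *)
Lemma codable_bigcup X (h : X -> nat -> nat) (B : nat -> set X) :
  code h -> (forall n, codable h (B n)) -> codable h (\bigcup_n B n).
Proof.
move=> ch cB; have [h' [ch' hh' h'B]] := codable_family ch cB.
have /ex_choice[g gP] : forall x, exists c, (c = 0%N /\ ~ (\bigcup_n B n) x) \/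
    exists n, [/\ c = n.+1, B n x & forall m, (m < n)%N -> ~ B m x].
  move=> x; have [[n _ Bnx]|nB] := pselect ((\bigcup_n B n) x); last first.
    by exists 0%N; left.
  have [m [Bmx mP]] := ex_least (ex_intro (fun n => B n x) n Bnx).
  by exists m.+1; right; exists m.
exists (fun x i => if i is i'.+1 then h' x i' else g x); split.
- apply: code_cons => // c x /= gc.
  have near n : B n x -> exists k, forall x', agree k (h' x) (h' x') -> B n x'.
    exact: (coded_open (h'B n)).
  have nearC n : ~ B n x -> exists k, forall x', agree k (h' x) (h' x') -> ~ B n x'.
    exact: (coded_open (coded_setC (h'B n))).
  case: c gc => [|n] gc.
    have [[]//|[n [_ Bn _]]] := gP x; have [k kP] := near n Bn.
    exists k => x' /kP Bx' g0; have [[_ nB]|[m [gm]]] := gP x'.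
      by apply: nB; exists n.
    by rewrite g0 in gm.
  have [Bn|nBn] := pselect (B n x); last first.
    have [k kP] := nearC n nBn; exists k => x' /kP nBx' gx'.
    have [[g0]|[m [gm Bm _]]] := gP x'; first by rewrite gx' in g0.
    by move: gm Bm; rewrite gx' => -[<-].
  have [[_ nB]|[m [gm Bm mP]]] := gP x; first by case: nB; exists n.
  have mn : (m < n)%N.
    rewrite ltn_neqAle leqNgt; apply/andP; split.
      by apply/eqP => mn; apply: gc; rewrite gm mn.
    by apply/negP => /mP.
  have [k kP] := near m Bm; exists k => x' /kP Bx' gx'.
  have [[g0]|[n' [gn' _ n'P]]] := gP x'; first by rewrite gx' in g0.
  by move: gn'; rewrite gx' => -[nn']; apply: (n'P m) => //; rewrite -nn'.
- by have [f fP] := hh'; exists (fun i => (f i).+1) => x i; rewrite fP.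
- exists 0%N, [set c | c <> 0%N] => x.
  have [[-> nB]|[n [-> Bn _]]] := gP x; split=> //.
  by move=> _; exists n.
Qed.

Lemma codable_bigcap X (h : X -> nat -> nat) (B : nat -> set X) :
  code h -> (forall n, codable h (B n)) -> codable h (\bigcap_n B n).
Proof.
move=> ch cB; rewrite -(setCK (\bigcap_n _)) setC_bigcap.
by apply/codable_setC/codable_bigcup => // n; exact: codable_setC.
Qed.

Lemma codable_countable_bigcup X (h : X -> nat -> nat) (J : countType) (B : J -> set X) :
  code h -> (forall n, codable h (B n)) -> codable h (\bigcup_n B n).
Proof.
move=> ch cB; rewrite bigcup_countType; apply: codable_bigcup => // n.
case: unpickle => //; apply: coded_codable => //.
by exists 0%N, set0 => x; split.
Qed.

Lemma open_for_codable X (h : X -> nat -> nat) U :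
  code h -> open_for h U -> codable h U.
Proof.
move=> ch hU.
pose piece (s : seq nat) := [set x | agree (size s) (h x) (nth 0%N s)].
have -> : U = \bigcup_s (if `[< piece s `<=` U >] then piece s else set0).
  apply/seteqP; split=> x; last by move=> [s _]; case: asboolP => // + sx; apply.
  move=> /hU[k kP]; exists (mkseq (h x) k) => //; case: asboolP => [_|].
    by move=> i; rewrite size_mkseq => ik; rewrite nth_mkseq.
  case=> x'; rewrite /piece/= size_mkseq => x'x; apply: kP => i ik.
  by rewrite x'x// nth_mkseq.
apply: codable_countable_bigcup => // s; case: asboolP => _; last first.
  by apply: coded_codable => //; exists 0%N, set0 => x; split.
have -> : piece s = \bigcap_i [set x | (i < size s)%N -> h x i = nth 0%N s i].
  by apply/seteqP; split=> [x sx i _ /=|x sx i i_s]; [exact: sx|exact: sx].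
apply: codable_bigcap => // i; apply: coded_codable => //.
by exists i, [set c | (i < size s)%N -> c = nth 0%N s i].
Qed.

(* Each point is coded by the trace on it of a countable family of closed sets,
   stable under "complements" in that the complement of a member is a union of
   members; non-membership is recorded with a witness. *)
Lemma code_of_family (X : Type) (J : countType) (C : J -> set X) (f : J -> nat -> J) :
  (forall j x, ~ C j x <-> exists l, C (f j l) x) ->
  (forall x y, (forall j, C j x <-> C j y) -> x = y) ->
  (forall x_ : nat -> X,
    (forall j, (exists N, forall n, (N <= n)%N -> C j (x_ n)) \/
       exists l N, forall n, (N <= n)%N -> C (f j l) (x_ n)) ->
    exists x, forall j, (exists N, forall n, (N <= n)%N -> C j (x_ n)) -> C j x) ->
  exists h, code h /\ forall j, open_for h (C j).
Proof.
move=> fP Cinj Clim.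
have /ex_choice[g gP] : forall p : X * J, exists c, (c = 0%N /\ C p.2 p.1) \/
    exists l, [/\ c = l.+1, C (f p.2 l) p.1 & forall m, (m < l)%N -> ~ C (f p.2 m) p.1].
  move=> [x j]; have [?|/fP/ex_least[l [? ?]]] := pselect (C j x).
    by exists 0%N; left.
  by exists l.+1; right; exists l.
have g0 x j : g (x, j) = 0%N <-> C j x.
  have [[-> //]|[l [-> Cl _]]] := gP (x, j); split=> // Cx.
  by exfalso; apply: ((fP j x).2 _ Cx); exists l.
pose h x i := if pickle_inv i is Some j then g (x, j) else 0%N.
have hE x j : h x (pickle j) = g (x, j) by rewrite /h pickleK_inv.
exists h; split; last first.
  move=> j x Cx; exists (pickle j).+1 => x' xx'.
  by apply/g0; rewrite -hE -xx'// hE; apply/g0.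
split.
  move=> x y xy; apply: Cinj => j.
  by rewrite -!g0 -!hE xy.
move=> y /ex_choice[x_ xP].
have gx_ j k : (pickle j < k)%N -> g (x_ k, j) = y (pickle j).
  by move=> jk; rewrite -hE xP.
have ev j : y (pickle j) = 0%N -> exists N, forall n, (N <= n)%N -> C j (x_ n).
  by move=> yj; exists (pickle j).+1 => n jn; apply/g0; rewrite gx_.
have evS j l : y (pickle j) = l.+1 -> exists N, forall n, (N <= n)%N -> C (f j l) (x_ n).
  move=> yj; exists (pickle j).+1 => n jn.
  have := gP (x_ n, j); rewrite gx_// yj => -[[]//|[l' [[<-]]]]//.
have [|x xC] := Clim x_.
  move=> j; case E : (y (pickle j)) => [|l]; [left; exact: ev|right; exists l].
  exact: evS.
have yC j : y (pickle j) = 0%N <-> C j x.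
  split=> [/ev/xC//|Cx]; case E : (y (pickle j)) => [//|l].
  by exfalso; apply: ((fP j x).2 _ Cx); exists l; apply/xC/evS.
exists x; apply/funext => i; rewrite /h.
case E : (pickle_inv i) => [j|]; last first.
  by have := xP i.+1 i (ltnSn i); rewrite /h E.
have := @pickle_invK J i; rewrite E /= => <-.
(* [x] and [x_ k] agree on every candidate witness up to the recorded one, so their least witnesses
   coincide. *)
have [l lP] := ex_bound (fun m => pickle (f j m)) (y (pickle j)).
pose k := maxn (pickle j).+1 l.
rewrite -(gx_ j k) ?leq_maxl//.
have Cf m : (m < y (pickle j))%N -> C (f j m) x <-> C (f j m) (x_ k).
  by move=> /lP ml; rewrite -yC -g0 gx_// (leq_trans ml)// leq_maxr.
have := gP (x_ k, j); rewrite gx_ ?leq_maxl//= => -[[y0 _]|[n [yn Cn nP]]].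
  by rewrite y0; apply/g0/yC.
rewrite yn; have [[gx /yC]|[n' [-> Cn' n'P]]] := gP (x, j); first by rewrite yn.
have nn' : (n' <= n)%N.
  by rewrite leqNgt; apply/negP => /n'P; apply; apply/Cf; rewrite ?yn.
congr S; apply/eqP; rewrite eqn_leq nn'/= leqNgt; apply/negP => n'n.
by apply: (nP n' n'n); apply/Cf => //; rewrite yn ltnW// ltnS.
Qed.

(** * Passage between Polish metrics and codes *)

Section PolishCode.
Import Order.TTheory GRing.Theory Num.Theory.
Local Open Scope ring_scope.

(** [code_of_family] is applied to balls and complements of balls with rational radii around a dense
    sequence. The indices [inl q] stand for the empty set: a witness of non-membership names a ball
    of radius [q] around the point, which makes sequences with convergent codes Cauchy. *)
Lemma polish_code (K : realType) (X : topologicalType) : polish K X ->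
  exists h : X -> nat -> nat, code h /\ forall U : set X, open U -> open_for h U.
Proof.
move=> [m [Mopen Mcomplete [D cD dD]]].
pose M : metricType K := Metric.Pack m.
pose d (x y : X) : K := @mdist K M x y.
have dxx x : d x x = 0 by exact: (@mdistxx _ M).
have dC x y : d x y = d y x by exact: (@metric_sym _ M).
have dtri x y z : d x z <= d x y + d y z by exact: (@metric_triangle _ M).
have d0 x y : d x y = 0 -> x = y by exact: (@mdist_positivity K M).
have dball (x : X) e : @ball K M x e = [set y | d x y < e] by exact: (@ballEmdist K M).
have [f finj] : exists f : X -> nat, {in D &, injective f} by apply/countable_injP.
have /ex_choice[p pP] : forall n, exists o : option X,
    forall x, D x -> f x = n -> o = Some x.
  move=> n; have [[x [Dx fx]]|nx] := pselect (exists x, D x /\ f x = n).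
    exists (Some x) => y Dy fy; congr Some.
    by apply: finj; rewrite ?inE// fx.
  by exists None => x Dx fx; case: nx; exists x.
have dense_p x e : 0 < e -> exists n z, p n = Some z /\ d z x < e.
  move=> e0; pose U := @interior M (@ball K M x e).
  have [z [Uz Dz]] : U `&` D !=set0.
    apply: dD; first by exists x; exact: (@nbhsx_ballx K M).
    by apply/Mopen; exact: (@open_interior M).
  exists (f z), z; split; first exact: pP.
  by have := @interior_subset M _ z Uz; rewrite dball dC.
have ratb (x y : K) : x < y -> exists q, x < ratr q < y.
  by move=> /rat_in_itvoo[q]; rewrite in_itv /= => ?; exists q.
pose C (j : rat + nat * rat * bool) : set X := match j with
  | inl _ => set0
  | inr (n, q, b) => if p n is Some z then
      (if b then [set x | ratr q <= d z x] else [set x | d z x <= ratr q])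
      else [set x | b] end.
(* The complement of one side of a radius is the union of the opposite sides over rational radii
   strictly beyond it; an inadmissible [l] is replaced by the radius [q - 1] or [q + 1], and a
   nonpositive ball radius by 1. *)
pose F (j : rat + nat * rat * bool) (l : nat) : rat + nat * rat * bool := match j with
  | inl q => inr (l, if 0 < q then q else 1, false)
  | inr (n, q, b) => let q' := odflt 0 (unpickle l : option rat) in
      if b then inr (n, if q' < q then q' else q - 1, false)
      else inr (n, if q < q' then q' else q + 1, true) end.
have ballC x e : 0 < e -> exists j, C j x /\ forall y, C j y -> d x y < e.
  move=> e0; have [q /andP[q0 qe]] : exists q, (0 : K) < ratr q < e / 2.
    by apply: ratb; rewrite divr_gt0.
  have [n [z [pn zx]]] := dense_p x _ q0.
  exists (inr (n, q, false)); rewrite /C pn; split; first exact: ltW.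
  move=> y /= zy; rewrite (le_lt_trans (dtri x z y))// (splitr e) ltrD//.
    by rewrite dC (lt_trans zx).
  by rewrite (le_lt_trans zy).
have [|||h [ch hC]] := @code_of_family X _ C F.
- move=> [q|[[n q] b]] x.
    split; [move=> _ |by move=> _ []].
    have [|n [z [pn zx]]] := dense_p x (ratr (if 0 < q then q else 1)).
      by rewrite ltr0q; case: ifP.
    by exists n; rewrite /C/= pn; exact: ltW.
  rewrite /C /=; case E : (p n) => [z|]; last first.
    by case: b; split => [|[l]] //=; rewrite ?E //= => _; exists 0%N; rewrite E.
  case: b => /=; split.
  + move=> /negP; rewrite -ltNge => zx.
    have [q' /andP[zq qq]] : exists q', d z x < (ratr q' : K) < ratr q.
      exact: ratb.
    by exists (pickle q'); rewrite E pickleK/= -(ltr_rat K) qq; exact: ltW.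
  + move=> [l]; rewrite E /= => zx; apply/negP; rewrite -ltNge (le_lt_trans zx)// ltr_rat.
    by case: ifP => //; rewrite ltrBlDr ltrDl.
  + move=> /negP; rewrite -ltNge => zx.
    have [q' /andP[zq qq]] : exists q', (ratr q : K) < ratr q' < d z x.
      exact: ratb.
    by exists (pickle q'); rewrite E pickleK/= -(ltr_rat K) zq; exact: ltW.
  + move=> [l]; rewrite E /= => zx; apply/negP; rewrite -ltNge (lt_le_trans _ zx)// ltr_rat.
    by case: ifP => //; rewrite ltrDl.
- move=> x y xy; apply: d0; apply/eqP; rewrite eq_le; apply/andP; split; last first.
    exact: (@mdist_ge0 K M).
  rewrite leNgt; apply/negP => xy0.
  have [j [/xy Cy /(_ _ Cy)]] := ballC x _ xy0.
  by rewrite ltxx.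
- move=> x_ ev.
  have [x xlim] : exists x : X, forall e, 0 < e -> exists N, forall n, (N <= n)%N -> d x (x_ n) < e.
    have [|x xlim] := Mcomplete x_.
      apply: cauchy_exP => e e0.
      have [q /andP[q0 qe]] : exists q, (0 : K) < ratr q < e.
        exact: ratb.
      rewrite ltr0q in q0.
      have [[N]/(_ N (leqnn N))//|[l [N]]] := ev (inl q).
      rewrite /C/= q0; case: (p l) => [z zN|/(_ N (leqnn N))//]; exists z.
      by exists N => // n /= /zN; rewrite dball /= => /le_lt_trans; apply.
    exists x => e e0; have /cvg_ballP/(_ e e0)[N _ NP] := xlim.
    by exists N => n /NP; rewrite dball.
  exists x => -[q|[[n q] b]] [N NC]; first by have := NC N (leqnn N).
  move: NC; rewrite /C; case: (p n) => [z|/(_ N (leqnn N))//].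
  case: b => /= NC; apply/ler_addgt0Pr => e e0; have [N' N'P] := xlim e e0.
    apply: le_trans (NC (maxn N N') (leq_maxl _ _)) _.
    by rewrite (le_trans (dtri _ x _))// lerD2l ltW// N'P// leq_maxr.
  apply: le_trans (dtri z (x_ (maxn N N')) x) _; apply: lerD.
    by apply: NC; rewrite leq_maxl.
  by rewrite dC ltW// N'P// leq_maxr.
exists h; split=> // U /Mopen oU x Ux.
have /nbhs_ballP[e /= e0 eU] : @nbhs M M x U by exact: (@open_nbhs_nbhs M).
have [j [Cx Cj]] := ballC x e e0.
have [k kP] := hC j x Cx; exists k => y /kP /Cj xy.
by apply: eU; rewrite dball.
Qed.

End PolishCode.

Section CodeTopology.
Import Order.TTheory GRing.Theory Num.Theory.
Local Open Scope ring_scope.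

(** The distance is the inverse of [k.+1], with [k] the first difference of the codes; the triangle
    inequality comes from transitivity of agreement. *)
Lemma code_distance (K : realType) (X : Type) (h : X -> nat -> nat) :
  injective h -> exists d : X -> X -> K,
  [/\ forall x, d x x = 0, forall x y, d x y = 0 -> x = y,
      forall x y, d x y = d y x, forall y x z, d x z <= d x y + d y z
    & forall x y k, d x y < k.+1%:R^-1 <-> agree k.+1 (h x) (h y)].
Proof.
move=> hinj.
have /ex_choice[d dP] : forall p : X * X, exists r : K,
    (p.1 = p.2 /\ r = 0) \/
    exists k, [/\ r = k.+1%:R^-1, agree k (h p.1) (h p.2) & h p.1 k <> h p.2 k].
  move=> [x y] /=; have [->|xy] := pselect (x = y); first by exists 0; left.
  have [|k [hk kP]] := @ex_least (fun k => h x k <> h y k).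
    apply: contrapT => /forallNP xyE; apply: xy; apply: hinj; apply/funext => i.
    by apply: contrapT; exact: xyE.
  exists k.+1%:R^-1; right; exists k; split=> // i ik.
  by apply: contrapT; exact: kP.
have invS_gt0 k : (0 : K) < k.+1%:R^-1 by rewrite invr_gt0 ltr0n.
have invS_lt (k l : nat) : ((k.+1%:R^-1 : K) < l.+1%:R^-1) = (l < k)%N.
  by rewrite ltf_pV2 ?posrE ?ltr0n// ltr_nat ltnS.
have dlt x y k : d (x, y) < k.+1%:R^-1 <-> agree k.+1 (h x) (h y).
  have [/= [-> ->]|[l [-> ag nag]]] := dP (x, y); first by split.
  rewrite invS_lt; split=> [kl i ik|ag']; first by apply: ag; exact: leq_trans kl.
  by rewrite ltnNge; apply/negP => lk; apply: nag; exact: ag'.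
have d_ge0 x y : 0 <= d (x, y).
  by have [[_ ->//]|[k [-> _ _]]] := dP (x, y); exact: ltW.
exists (fun x y => d (x, y)); split.
- by move=> x; have [[]//|[k [_ _ /=]]] := dP (x, x).
- move=> x y xy; have [[]//|[k [dk _ _]]] := dP (x, y).
  by have := invS_gt0 k; rewrite -dk xy ltxx.
- move=> x y; have [[/= <- //]|[k [-> ag nag]]] := dP (x, y).
  have [[/= yx _]|[l [-> ag' nag']]] := dP (y, x); first by case: nag; rewrite yx.
  suff -> : k = l by [].
  apply/eqP; rewrite eqn_leq; apply/andP.
  by split; rewrite leqNgt; apply/negP; [move=> /ag /= e; apply: nag'|move=> /ag' /= e; apply: nag].
- move=> y x z; have [[_ ->]|[k [dk ag nag]]] := dP (x, z); first exact: addr_ge0.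
  rewrite dk leNgt; apply/negP => xyz; apply: nag => /=.
  have xy : agree k.+1 (h x) (h y).
    by apply/dlt; apply: le_lt_trans xyz; rewrite lerDl.
  have yz : agree k.+1 (h y) (h z).
    by apply/dlt; apply: le_lt_trans xyz; rewrite lerDr.
  by rewrite xy// yz.
- exact: dlt.
Qed.

Section DistanceSpace.
Variables (K : realType) (X : choiceType) (d : X -> X -> K).
Hypotheses (dxx : forall x, d x x = 0) (d0 : forall x y, d x y = 0 -> x = y).
Hypotheses (dC : forall x y, d x y = d y x).
Hypothesis (dtri : forall y x z, d x z <= d x y + d y z).

(** An alias of [X] depending on the metric axioms, so that a metric structure can be attached to
    it. *)
Definition distance_space
  (_ : forall x, d x x = 0) (_ : forall x y, d x y = 0 -> x = y)
  (_ : forall x y, d x y = d y x) (_ : forall y x z, d x z <= d x y + d y z) : Type := X.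

Local Notation M := (distance_space dxx d0 dC dtri).
HB.instance Definition _ := Choice.copy M X.
HB.instance Definition _ := @isMetric.Build K M d dxx d0 dC dtri.

End DistanceSpace.

(** Completeness is closedness of the range of [h]; a dense countable set takes a point from each
    nonempty basic set. *)
Lemma code_polish (K : realType) (X : choiceType) (h : X -> nat -> nat) :
  code h -> exists tX : Topological.axioms_ X,
    let X' : topologicalType := Topological.Pack tX in
    polish K X' /\
    forall (x : X) (U : set X), @nbhs X' X' x U <->
      exists k, forall y, agree k (h x) (h y) -> U y.
Proof.
move=> [hinj hrange]; have [d [dxx d0 dC dtri dlt]] := code_distance K hinj.
pose M : metricType K := distance_space dxx d0 dC dtri.
have small_inv (e : K) : 0 < e -> exists k : nat, k.+1%:R^-1 < e.
  move=> e0; exists (Num.bound e^-1).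
  have e1 : 0 <= e^-1 by rewrite invr_ge0 ltW.
  rewrite invf_plt ?posrE//; apply: (lt_le_trans (archi_boundP e1)).
  by rewrite ler_nat.
have nbhsM (x : M) (U : set M) : nbhs x U <->
    exists k, forall y, agree k (h x) (h y) -> U y.
  split=> [/nbhs_ballP[e /= e0 eU]|[k kU]].
    have [k ke] := small_inv e e0; exists k.+1 => y /dlt xy; apply: eU.
    by rewrite ballEmdist /=; exact: lt_trans ke.
  apply/nbhs_ballP; exists k.+1%:R^-1 => /=; first by rewrite invr_gt0 ltr0n.
  move=> y; rewrite ballEmdist /= => /dlt xy; apply: kU; exact: agree_le xy.
exists (Topological.class M); split; last exact: nbhsM.
exists (Metric.class M); split=> //.
- move=> u /cauchy_ballP uc.
  have {uc}near_u k : exists N, forall n, (N <= n)%N -> agree k (h (u N)) (h (u n)).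
    have [|[A B] /= [[N _ NA] [N' _ N'B]] AB] := uc k.+1%:R^-1.
      by rewrite invr_gt0 ltr0n.
    exists (maxn N N') => n Nn; apply: (agree_le (leqnSn k)); apply/dlt.
    have : A (u (maxn N N')) /\ B (u n).
      by split; [apply: NA|apply: N'B] => /=; rewrite ?leq_maxl// (leq_trans _ Nn)// leq_maxr.
    by move=> /(AB (_, _)) /=; rewrite ballEmdist.
  have /ex_choice[N NP] := near_u.
  pose y i := h (u (N i.+1)) i.
  have yP k n : (forall i, (i < k)%N -> (N i.+1 <= n)%N) -> agree k (h (u n)) y.
    by move=> kn i ik; rewrite /y (NP i.+1 n)// kn.
  have bound k : exists n0, forall i, (i < k)%N -> (N i.+1 <= n0)%N.
    by have [l lP] := ex_bound (fun i => N i.+1) k; exists l => i /lP/ltnW.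
  have [|x xy] := hrange y.
    by move=> k; have [n0 n0P] := bound k; exists (u n0); exact: yP.
  exists x => U /nbhsM[k kU]; have [n0 n0P] := bound k.
  exists n0 => // n /= n0n; apply: kU; rewrite xy; apply: agree_sym.
  by apply: yP => i /n0P iN; exact: leq_trans n0n.
- have /ex_choice[p pP] : forall s : seq nat, exists o : option X,
      forall x, agree (size s) (h x) (nth 0%N s) ->
        exists y, o = Some y /\ agree (size s) (h y) (nth 0%N s).
    move=> s; have [[x xs]|nx] := pselect (exists x, agree (size s) (h x) (nth 0%N s)).
      by exists (Some x) => _ _; exists x.
    by exists None => x xs; case: nx; exists x.
  exists [set y | exists s, p s = Some y].
    apply: (@sub_countable _ _ _ (\bigcup_(s in [set: seq nat]) [set y | p s = Some y])).
      by apply: subset_card_le => y [s ys]; exists s.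
    apply: bigcup_countable => // s _.
    case E : (p s) => [z|]; last by rewrite (_ : [set _ | _] = set0)//; apply/seteqP; split.
    by rewrite (_ : [set _ | _] = [set z]); [exact: countable1|apply/seteqP; split=> [y [->]|y ->]].
  move=> O [x Ox] oO.
  have /nbhsM[k kO] : nbhs (x : M) O by exact: open_nbhs_nbhs.
  have [|y [py yx]] := pP (mkseq (h x) k) x.
    by move=> i; rewrite size_mkseq => ik; rewrite nth_mkseq.
  exists y; split; last by exists (mkseq (h x) k).
  apply: kO => i ik; rewrite size_mkseq in yx.
  by rewrite yx// nth_mkseq.
Qed.

End CodeTopology.

Lemma code_potentially_closed (K : realType) (X : topologicalType)
    (h : X -> nat -> nat) (F : set (X * X)) :
  code h -> (forall U : set X, open U -> open_for h U) ->
  (forall x y, ~ F (x, y) -> exists k, forall x' y', agree k (h x) (h x') ->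
    agree k (h y) (h y') -> ~ F (x', y')) ->
  potentially_closed K F.
Proof.
move=> ch hopen Fc; have [tX [pX nX]] := code_polish K ch.
have fX : finer tX.
  by move=> U /hopen hU; rewrite openE => x /hU[k kU]; apply/nX; exists k.
exists tX, tX; split=> //.
rewrite -openC openE => -[x y] /Fc[k kF].
exists ([set x' | agree k (h x) (h x')], [set y' | agree k (h y) (h y')]).
  by split; apply/nX; exists k.
by move=> [x' y'] [xx' yy']; exact: kF.
Qed.

(** * Topology and Borel codes on cantor2 *)

Lemma nbhs_cantor (x : cantor_space) (A : set cantor_space) :
  nbhs x A <-> exists k, forall y, agree k x y -> A y.
Proof.
split=> [|[k kA]].
  pose F : set_system cantor_space := [set A | exists k, forall y, agree k x y -> A y].
  have FF : Filter F.
    split; first by exists 0%N.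
    - move=> P Q [k kP] [l lQ]; exists (maxn k l) => y xy; split.
        by apply: kP; apply: agree_le xy; rewrite leq_maxl.
      by apply: lQ; apply: agree_le xy; rewrite leq_maxr.
    - by move=> P Q PQ [k kP]; exists k => y /kP/PQ.
  suff : F --> x by apply.
  apply/cvg_sup => i U.
  have /= -> := @nbhsE (initial_topology (fun f : forall _ : nat, bool => f i)) x.
  case=> B [[C _ <-] /= Cx] BU; exists i.+1 => y xy; apply: BU.
  by rewrite /preimage/= -xy.
apply: (@filterS _ _ _ [set y | agree k x y]); first by move=> y /kA.
elim: k {kA} => [|k IH]; first by apply: filterS filterT => y _ i.
have pk : nbhs x [set y : cantor_space | x k = y k].
  have /= := @proj_continuous nat (fun=> bool) k x; apply.
  by rewrite nbhs_principalE; apply/principal_filterP.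
apply: filterS (filterI IH pk) => y [xy xk] i.
by rewrite ltnS leq_eqVlt => /predU1P[->|/xy].
Qed.

Lemma nbhs_cantor2 (p : cantor2) (A : set cantor2) :
  nbhs p A <-> exists k, forall q, pagree k p q -> A q.
Proof.
split=> [[[P Q] /= [/nbhs_cantor[k kP] Qp] PQA]|[k kA]].
  exists k => q [pq1 pq2]; rewrite (surjective_pairing q); apply: PQA; split=> /=.
    exact: kP.
  by rewrite -pq2; exact: nbhs_singleton.
exists ([set x | agree k p.1 x], [set p.2]) => /=; last first.
  by move=> q [/= pq1 pq2]; apply: kA; split.
split; first by apply/nbhs_cantor; exists k.
by rewrite nbhs_principalE; apply/principal_filterP.
Qed.

Lemma nbhs_cantor2_prod (p q : cantor2) (A : set (cantor2 * cantor2)) :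
  nbhs (p, q) A <->
  exists k, forall p' q', pagree k p p' -> pagree k q q' -> A (p', q').
Proof.
split=> [[[P Q] /= [/nbhs_cantor2[k kP] /nbhs_cantor2[l lQ]] PQA]|[k kA]].
  exists (maxn k l) => p' q' [p1 p2] [q1 q2]; apply: PQA; split=> /=.
    by apply: kP; split=> //; apply: agree_le p1; rewrite leq_maxl.
  by apply: lQ; split=> //; apply: agree_le q1; rewrite leq_maxr.
exists ([set p' | pagree k p p'], [set q' | pagree k q q']) => /=.
  by split; apply/nbhs_cantor2; exists k.
by move=> [p' q'] [/= ? ?]; exact: kA.
Qed.

Lemma open_borel (T : topologicalType) (U : set T) : open U -> borel U.
Proof. exact: sub_sigma_algebra. Qed.

Lemma borel_ind (T : topologicalType) (P : set (set T)) :
  (forall U, open U -> P U) -> (forall A, P A -> P (~` A)) ->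
  (forall A : nat -> set T, (forall n, P (A n)) -> P (\bigcup_n A n)) ->
  forall B, borel B -> P B.
Proof.
move=> Popen PC Pcup B; apply; split=> //; split=> //; first exact: Popen open0.
by move=> A PA; rewrite setTD; exact: PC.
Qed.

Lemma borel_setC (T : topologicalType) (A : set T) : borel A -> borel (~` A).
Proof. by move=> bA; rewrite -setTD; exact: sigma_algebraCD. Qed.

Lemma borel_bigcup (T : topologicalType) (A : nat -> set T) :
  (forall n, borel (A n)) -> borel (\bigcup_n A n).
Proof. exact: sigma_algebra_bigcup. Qed.

Lemma borel_map_open (X Y : topologicalType) (u : X -> Y) :
  (forall U, open U -> borel (u @^-1` U)) -> borel_map u.
Proof.
move=> uo; apply: borel_ind => // [A bA|A bA].
  by rewrite preimage_setC; exact: borel_setC.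
by rewrite preimage_bigcup; exact: borel_bigcup.
Qed.

Lemma bor_starts s : bor [set x | starts s x].
Proof.
have -> : [set x | starts s x] =
    \bigcap_i [set x | (i < size s)%N -> x i = nth false s i].
  apply/seteqP; split=> x; first by move/startsP => xs i _; exact: xs.
  by move=> xs; apply/startsP => i; exact: (xs i I).
apply: bor_bigcap => i; have [i_s|i_s] := ltnP i (size s); last first.
  by rewrite (_ : [set _ | _] = setT); [exact: borT|apply/seteqP; split].
case: (nth false s i).
  rewrite (_ : [set _ | _] = bit i); first exact: bor_coord.
  by apply/seteqP; split=> x /=; [apply|].
rewrite (_ : [set _ | _] = ~` bit i); first exact/bor_setC/bor_coord.
by apply/seteqP; split=> x; rewrite /setC/bit/=; [move=> ->|move/negP/negbTE].
Qed.

Lemma borel_slice (B : set cantor2) e : borel B -> bor [set x | B (x, e)].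
Proof.
move: B; apply: borel_ind.
- move=> U; rewrite openE => oU.
  have -> : [set x | U (x, e)] = \bigcup_s
      (if `[< forall x, starts s x -> U (x, e) >] then [set x | starts s x] else set0).
    apply/seteqP; split=> x; last by move=> [s _]; case: asboolP => // sU /sU.
    move=> /oU/nbhs_cantor2[k kU]; exists (mkseq x k) => //.
    case: asboolP => [_|[]]; first exact: starts_mkseq.
    move=> y /startsP; rewrite size_mkseq => yx; apply: kU; split=> //= i ik.
    by rewrite yx// nth_mkseq.
  apply: bor_countable_bigcup => s; case: asboolP => _; [exact: bor_starts|exact: bor0].
- by move=> A bA; exact: bor_setC.
- by move=> A bA; have := bor_bigcup bA; congr bor; apply/seteqP; split.
Qed.

Lemma open_pagree (C : set (cantor2 * cantor2)) :
  (forall p q, (forall k, exists p' q',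
     [/\ pagree k p p', pagree k q q' & C (p', q')]) -> C (p, q)) ->
  open (~` C).
Proof.
move=> Ccl; rewrite openE => -[p q] nC; apply/nbhs_cantor2_prod.
apply: contrapT => /forallNP h; apply: nC; apply: Ccl => k.
apply: contrapT => nk; apply: (h k) => p' q' pp' qq' Cpq.
by apply: nk; exists p', q'.
Qed.

Definition rel_set sym refl (a : nat -> bool) : set (cantor2 * cantor2) :=
  [set pq | rel_of sym refl a pq.1 pq.2].

Definition limit_set sym : set (cantor2 * cantor2) :=
  [set pq | limit_of sym pq.1 pq.2].

Lemma open_setC_limit sym : open (~` limit_set sym).
Proof.
apply: open_pagree => p q app; split.
- apply/funext => i; have [p' [q' [[p1 _] [q1 _] [/= pq _ _]]]] := app i.+1.
  by rewrite p1// pq q1.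
- by have [p' [q' [[_ ->] [_ ->] [/= _ -> _]]]] := app 0%N.
- by have [p' [q' [[_ ->] [_ _] [/= _ _ ->]]]] := app 0%N.
Qed.

Lemma open_setC_rel_limit sym refl a : open (~` (rel_set sym refl a `|` limit_set sym)).
Proof. by apply: open_pagree => p q /rel_of_closed. Qed.

Lemma rel_setE sym refl a : rel_set sym refl a =
  ~` limit_set sym `\` ~` (rel_set sym refl a `|` limit_set sym).
Proof.
apply/seteqP; split=> [[p q] r|[p q] [nl] /contrapT[//|//]].
by split; [exact: rel_of_limit_disjoint r|move=> []; left].
Qed.

(** * Borel codes of the relations *)

Definition complement_code (c : nat -> nat -> bool) : cantor_space :=
  fun n => if n is n'.+1 then
    if unpickle n' is Some (i, j) then c i j else false else true.

Definition open_code (b : nat -> bool) : cantor_space :=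
  fun n => if n is n'.+1 then b n' else false.

Lemma complement_codeP c (A : nat -> set (cantor2 * cantor2)) :
  (forall i, borel_code (c i) (A i)) ->
  borel_code (complement_code c) (~` \bigcup_i A i).
Proof.
move=> cA; apply: code_setC_bigcup => // i.
suff -> : code_section (complement_code c) i = c i by exact: cA.
by apply/funext => n; rewrite /code_section /= pickleK.
Qed.

(* Only products of cylinders of the same length are listed, so that the code of
   the complement of the closure of [rel_set sym refl a] is continuous in [a]. *)
Definition square_cylinder (n : nat) : bool :=
  if unpickle n is Some (p, q) then
    size (p : seq bool * bool).1 == size (q : seq bool * bool).1 else false.

Definition inner_code (O : set (cantor2 * cantor2)) : nat -> bool :=
  fun n => square_cylinder n && `[< basic_open n `<=` O >].

Lemma open_codeP (O : set (cantor2 * cantor2)) : open O ->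
  borel_code (open_code (inner_code O)) O.
Proof.
move=> oO; have := @code_open (open_code (inner_code O)) erefl.
congr borel_code; apply/seteqP; split=> [pq [n /= /andP[_ /asboolP]]|[p q]]; first exact.
move: oO; rewrite openE => oO /oO/nbhs_cantor2_prod[k kO].
have cyl (r : cantor2) k' : cylinder (mkseq r.1 k', r.2) r.
  by split=> // i; rewrite size_mkseq => ik; rewrite nth_mkseq.
have cyl_pagree (r r' : cantor2) : cylinder (mkseq r.1 k, r.2) r' -> pagree k r r'.
  by move=> [/= rr' r2]; split=> // i ik; rewrite rr' ?size_mkseq// nth_mkseq.
exists (pickle ((mkseq p.1 k, p.2), (mkseq q.1 k, q.2))).
  rewrite /= /inner_code /square_cylinder pickleK !size_mkseq eqxx; apply/asboolP.
  rewrite /basic_open pickleK => -[p' q'] [/= /cyl_pagree pp' /cyl_pagree qq'].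
  exact: kO.
by rewrite /basic_open pickleK; split; exact: cyl.
Qed.

(** The nesting follows [setD_complements]. The first open set does not depend on [a], so continuity
    concerns the second one only. *)
Definition rel_code sym refl (a : cantor_space) : cantor_space :=
  complement_code (fun i => if i is 0 then
      complement_code (fun=> open_code (inner_code (~` limit_set sym)))
    else open_code (inner_code (~` (rel_set sym refl a `|` limit_set sym)))).

Lemma setD_complements (T : Type) (A B : set T) :
  A `\` B = ~` \bigcup_n (if n is 0 then ~` \bigcup_(_ in [set: nat]) A else B).
Proof.
apply/seteqP; split=> [x [Ax nB] [[|n] _ //]|x nAB]; first by apply; exists 0%N.
split; last by move=> Bx; apply: nAB; exists 1%N.
by apply: contrapT => nA; apply: nAB; exists 0%N => // -[].
Qed.

Lemma borel_rel_set sym refl a : borel (rel_set sym refl a).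
Proof.
rewrite rel_setE setD_complements; apply: borel_setC; apply: borel_bigcup; case=> [|n].
  apply: borel_setC; apply: borel_bigcup => _; apply: open_borel.
  exact: open_setC_limit.
apply: open_borel; exact: open_setC_rel_limit.
Qed.

Lemma rel_codeP sym refl a : borel_code (rel_code sym refl a) (rel_set sym refl a).
Proof.
rewrite [X in borel_code _ X]rel_setE setD_complements.
apply: complement_codeP => -[|i]; last exact/open_codeP/open_setC_rel_limit.
by apply: complement_codeP => _; exact/open_codeP/open_setC_limit.
Qed.

Lemma levels_agree k a b c : agree k a b -> (c <= k)%N -> levels a c = levels b c.
Proof.
move=> ab ck; rewrite /levels; have [//|c0] := posnP c.
rewrite /toeplitz ab//; apply: leq_trans ck.
by rewrite -divn2; apply: leq_ltn_trans (leq_div _ _) (ltn_logl _ c0).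
Qed.

(** A flip below [k] involves fewer than [k] preceding ones, a level on which [a] and [b] agree. For
    a flip from [k] on, both ends share their first [k] bits, and a limit pair, which does not
    depend on the parameter, meets the same cylinders. *)
Lemma rel_limit_meets sym refl k (a b : nat -> bool) (r s : seq bool * bool) :
  size r.1 = k -> size s.1 = k -> agree k a b ->
  (exists p q, [/\ cylinder r p, cylinder s q & rel_of sym refl a p q \/ limit_of sym p q]) ->
  exists p q, [/\ cylinder r p, cylinder s q & rel_of sym refl b p q \/ limit_of sym p q].
Proof.
move=> rk sk ab [p [q [rp sq]]].
have near (x y : cantor2) n : (k <= n)%N -> y.1 = flip n x.1 ->
    forall i, (i < k)%N -> y.1 i = x.1 i.
  by move=> kn -> i ik; apply: agree_flip ik.
have move_q : (forall i, (i < k)%N -> q.1 i = p.1 i) -> cylinder s (p.1, q.2).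
  by move=> qp; case: sq => sq1 sq2; split=> // i ik; rewrite -sq1 ?qp// -sk.
case=> [[|[sy]|[rf pq]]|lim].
- move=> [p2 q2 [n [pn qE lev]]]; have [nk|kn] := ltnP n k.
    exists p, q; split=> //; left; apply: Or31; split=> //; exists n; split=> //.
    by rewrite -(levels_agree ab)// (leq_trans (ones_le _ _))// ltnW.
  exists p, (p.1, q.2); split=> //; first exact/move_q/(near p q n).
  by right; split; rewrite //= ?p2 ?q2 ?orbT.
- move=> [q2 p2 [n [qn pE lev]]]; have [nk|kn] := ltnP n k.
    exists p, q; split=> //; left; apply: Or32; split=> //; split=> //; exists n; split=> //.
    by rewrite -(levels_agree ab)// (leq_trans (ones_le _ _))// ltnW.
  exists p, (p.1, q.2); split=> //.
    by apply: move_q => i ik; rewrite (near q p n).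
  by right; split; rewrite //= ?p2 ?q2 ?sy.
- by exists p, q; split=> //; left; apply: Or33.
- by exists p, q; split=> //; right.
Qed.

Lemma rel_code_continuous sym refl : continuous (rel_code sym refl).
Proof.
move=> a A /nbhs_cantor[m mA].
have inner n : exists k, forall b, agree k a b ->
    inner_code (~` (rel_set sym refl a `|` limit_set sym)) n =
    inner_code (~` (rel_set sym refl b `|` limit_set sym)) n.
  rewrite /inner_code /square_cylinder /basic_open.
  case: unpickle => [[r s]|]; last by exists 0%N.
  have [rs|] := eqVneq; last by exists 0%N.
  exists (size r.1) => b ab.
  have E c c' : agree (size r.1) c c' ->
      cylinder r `*` cylinder s `<=` ~` (rel_set sym refl c `|` limit_set sym) ->
      cylinder r `*` cylinder s `<=` ~` (rel_set sym refl c' `|` limit_set sym).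
    move=> cc' rsc [p q] [/= rp sq] pq.
    have ex : exists p q, [/\ cylinder r p, cylinder s q &
        rel_of sym refl c' p q \/ limit_of sym p q] by exists p, q.
    have [p' [q' [rp' sq' pq']]] := rel_limit_meets erefl (esym rs) (agree_sym cc') ex.
    exact: (rsc (p', q')).
  by apply/asboolP/asboolP; apply: E => //; exact: agree_sym.
have /ex_choice[k kP] n : exists k, forall b, agree k a b ->
    rel_code sym refl a n = rel_code sym refl b n.
  case: n => [|n]; first by exists 0%N.
  rewrite /rel_code /complement_code; case: unpickle => [[[|i] j]|]; try by exists 0%N.
  by case: j => [|j]; [exists 0%N|exact: inner].
have [l lP] := ex_bound k m.
apply/nbhs_cantor; exists l => b ab; apply: mA => n nm.
by apply: kP; apply: agree_le ab; exact/ltnW/lP.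
Qed.

(** * Potential closedness and minimality *)

(** The graph of [h] is closed because [h] refines the topology, so the slice and its complement are
    both analytic, and Lusin separation makes the slice Borel. *)
Lemma bor_code_slice (h : cantor2 -> nat -> nat) (e : bool) (N : set (nat -> nat)) l :
  code h -> (forall U : set cantor2, open U -> open_for h U) ->
  (forall y y', agree l y y' -> N y -> N y') ->
  bor [set x | N (h (x, e))].
Proof.
move=> [_ hr] ho Nl.
have an (P : set (nat -> nat)) : (forall y y', agree l y y' -> P y -> P y') ->
    analytic [set x | P (h (x, e))].
  move=> Pl; exists (fun x y => h (x, e) = y /\ P y).
    move=> x y app; split; last first.
      have [x' [y' [[_ Py'] _ yy']]] := app l; exact: Pl (agree_sym yy') Py'.
    have [|p hp] := hr y.
      by move=> k; have [x' [y' [[<- _] _ yy']]] := app k; exists (x', e); exact: agree_sym.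
    suff -> : (x, e) = p by [].
    have near m : pagree m (x, e) p.
      have op : open [set q : cantor2 | pagree m p q].
        rewrite openE => q [pq1 pq2]; apply/nbhs_cantor2; exists m => r [qr1 qr2].
        by split; [exact: agree_trans pq1 qr1|rewrite pq2].
      have [|k kP] := ho _ op p; first by split.
      have [x' [y' [[hx' _] xx' yy']]] := app (maxn k m).
      have [|px' pe] := kP (x', e).
        by rewrite hp hx'; apply: agree_le yy'; rewrite leq_maxl.
      split=> /=; last by rewrite pe.
      apply: agree_trans (agree_sym px').
      by apply: agree_le xx'; rewrite leq_maxr.
    rewrite (surjective_pairing p); have [_ <-] := near 0%N; congr pair.
    by apply/funext => i; have [+ _] := near i.+1; apply.
  by apply/seteqP; split=> [x Px|x [y [<-]]//]; exists (h (x, e)).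
have [||x Nx nNx|B [bB NB CB]] := @lusin_separation [set x | N (h (x, e))] [set x | ~ N (h (x, e))].
- exact: an.
- apply: (an (~` N)) => y y' yy'; apply: contra_not; exact/Nl/agree_sym.
- exact: nNx.
- suff -> : [set x | N (h (x, e))] = B by [].
  apply/seteqP; split=> // x Bx; apply: contrapT => /CB; exact.
Qed.

(** Were the relation closed, each pair of copies of a point would lie in a basic box missing it.
    The countably many boxes give a Borel cover of the Cantor space, and a member containing both
    ends of an allowed edge contradicts the choice of its box. *)
Lemma rel_set_not_potentially_closed (K : realType) sym refl a :
  ~ potentially_closed K (rel_set sym refl a).
Proof.
move=> [tX [tY [[pX fX] [pY fY] cR]]].
have [hX [chX hXo]] := polish_code pX; have [hY [chY hYo]] := polish_code pY.
pose B (st : seq nat * seq nat) : set (nat -> bool) :=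
  if `[< forall p q, agree (size st.1) (hX p) (nth 0%N st.1) ->
           agree (size st.2) (hY q) (nth 0%N st.2) -> ~ rel_set sym refl a (p, q) >]
  then [set x | agree (size st.1) (hX (x, false)) (nth 0%N st.1)] `&`
       [set x | agree (size st.2) (hY (x, true)) (nth 0%N st.2)] else set0.
have bslice h e s : code h -> (forall U : set cantor2, open U -> open_for h U) ->
    bor [set x | agree (size s) (h (x, e)) (nth 0%N s)].
  move=> ch ho.
  apply: (@bor_code_slice h e [set y | agree (size s) y (nth 0%N s)] (size s)) => //.
  by move=> y y' yy' ys; apply: agree_trans (agree_sym yy') ys.
have [||st [x [y [Bx By ed]]]] := @bor_cover_edge _ a B.
- move=> st; rewrite /B; case: asboolP => _; last exact: bor0.
  by apply: bor_setI; apply: bslice => // U oU; [apply/hXo/fX|apply/hYo/fY].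
- move=> x; have : ~ rel_set sym refl a ((x, false), (x, true)).
    by move/rel_of_levels; exact: edge_irrefl.
  move: cR; rewrite -openC openE => oR /oR[[P Q] /= [nP nQ] PQ].
  have [k kP] := hXo _ (@open_interior (Topological.Pack tX) P) _ nP.
  have [l lQ] := hYo _ (@open_interior (Topological.Pack tY) Q) _ nQ.
  exists (mkseq (hX (x, false)) k, mkseq (hY (x, true)) l).
  have agk n (y : nat -> nat) : agree (size (mkseq y n)) y (nth 0%N (mkseq y n)).
    by move=> i; rewrite size_mkseq => i_n; rewrite nth_mkseq.
  rewrite /B; case: asboolP => [_|[]]; first by split; exact: agk.
  move=> p q px qy; apply: (PQ (p, q)); split=> /=.
    apply: (@interior_subset (Topological.Pack tX)); apply: kP => i ik.
    by rewrite px /= ?size_mkseq// nth_mkseq.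
  apply: (@interior_subset (Topological.Pack tY)); apply: lQ => i il.
  by rewrite qy /= ?size_mkseq// nth_mkseq.
move: Bx By; rewrite /B; case: asboolP => // free [Bx _] [_ By].
by apply: (free (x, false) (y, true)) => //; apply/rel_of_levels.
Qed.

Lemma borel_codable (X : topologicalType) (h : X -> nat -> nat) (B : set X) :
  code h -> (forall U : set X, open U -> open_for h U) -> borel B -> codable h B.
Proof.
move=> ch ho; move: B; apply: borel_ind => [U oU|A|A cA].
- by apply: open_for_codable => //; exact: ho.
- exact: codable_setC.
- exact: codable_bigcup.
Qed.

Lemma bor_codable (X : Type) (h : X -> nat -> nat) (w : X -> nat -> bool)
    (B : set (nat -> bool)) :
  code h -> (forall i, codable h [set x | w x i]) -> bor B -> codable h (w @^-1` B).
Proof.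
move=> ch hw; elim=> [n|A _ cA|A _ cA].
- exact: hw.
- by rewrite preimage_setC; exact: codable_setC.
- by rewrite preimage_bigcup; exact: codable_bigcup.
Qed.

Lemma bool_coded (X : Type) (h : X -> nat -> nat) (f : X -> bool) x :
  coded h [set x | f x] -> exists k, forall y, agree k (h x) (h y) -> f x = f y.
Proof.
move=> fc; case fx : (f x).
  by have [k kP] := coded_open fc fx; exists k => y /kP.
have [|k kP] := coded_open (coded_setC fc) (x := x); first by rewrite /setC/= fx.
by exists k => y /kP /negP/negbTE.
Qed.

Section Minimality.
Variables (K : realType) (sym refl : bool) (a : nat -> bool).
Variables (X : topologicalType) (F : set (X * X)) (u : X -> cantor2).
Hypothesis FE : F = (fun p : X * X => (u p.1, u p.2)) @^-1` rel_set sym refl a.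
Variable h : X -> nat -> nat.
Hypothesis ch : code h.
Hypothesis ho : forall U : set X, open U -> open_for h U.
Hypothesis u1 : forall i, coded h [set x | (u x).1 i].
Hypothesis u2 : coded h [set x | (u x).2].

Lemma coded_continuous x m :
  exists k, forall y, agree k (h x) (h y) -> pagree m (u x) (u y).
Proof.
have /ex_choice[f fP] : forall i, exists k, forall y, agree k (h x) (h y) ->
    (u x).1 i = (u y).1 i by move=> i; exact: bool_coded.
have [k kP] := bool_coded x u2; have [l lP] := ex_bound f m.
exists (maxn k l) => y xy; split.
  move=> i im; apply: fP; apply: agree_le xy.
  by rewrite (leq_trans (ltnW (lP i im)))// leq_maxr.
by apply: kP; apply: agree_le xy; rewrite leq_maxl.
Qed.

Definition fibers : set (nat -> bool) :=
  [set x | (exists p, u p = (x, false)) /\ exists q, u q = (x, true)].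

(** The preimages of the sets [B n] covering [fibers] are made clopen. Near a pair sent to a limit
    pair, both images stay over one [B n], which has no adjacent points, and in different copies, so
    they are unrelated. Elsewhere [rel_of_closed] suffices. *)
Lemma small_fibers_potentially_closed : small fibers -> potentially_closed K F.
Proof.
move=> [B BP fB].
have [|h' [ch' hh' h'B]] := @codable_family _ h nat (fun n => [set x | B n (u x).1]) ch.
  move=> n; apply: (@bor_codable _ h (fun x => (u x).1)) => //; last exact: (BP n).1.
  by move=> i; exact: coded_codable.
have cont x m : exists k, forall y, agree k (h' x) (h' y) -> pagree m (u x) (u y).
  have [k kP] := coded_continuous x m; have [l lP] := refines_agree k hh'.
  by exists l => y xy; exact/kP/lP.
apply: (@code_potentially_closed K X h') => //.
  by move=> U /ho; exact: refines_open_for.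
move=> x y; rewrite FE /= => nR.
have [lim|nlim] := pselect (limit_of sym (u x) (u y)).
  have [n Bn] : exists n, B n (u x).1.
    have [xy1 xy2 _] := lim.
    have [|n _ Bn] := fB (u x).1; last by exists n.
    have xE := surjective_pairing (u x); have yE := surjective_pairing (u y).
    move: xE yE; rewrite xy2 -xy1; case: (u x).2 => xE yE.
      by split; [exists y|exists x].
    by split; [exists x|exists y].
  have Bny : B n (u y).1 by have [<-] := lim.
  have [k kP] := coded_open (h'B n) Bn; have [k' kP'] := coded_open (h'B n) Bny.
  have [l lP] := cont x 0%N; have [l' lP'] := cont y 0%N.
  exists (maxn (maxn k l) (maxn k' l')) => x' y' xx' yy'.
  have Bx' : B n (u x').1 by apply: kP; apply: agree_le xx'; rewrite !leq_max leqnn.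
  have By' : B n (u y').1.
    by apply: kP'; apply: agree_le yy'; rewrite !leq_max leqnn ?orbT.
  have [_ x2] : pagree 0 (u x) (u x').
    by apply: lP; apply: agree_le xx'; rewrite !leq_max leqnn ?orbT.
  have [_ y2] : pagree 0 (u y) (u y').
    by apply: lP'; apply: agree_le yy'; rewrite !leq_max leqnn ?orbT.
  have [_ xy2 _] := lim.
  case=> [[_ _ [m [_ yE _]]]|[_ [_ _ [m [_ xE _]]]]|[_ /= uxy]].
  - by apply: ((BP n).2 m (u x').1) => //; rewrite -yE.
  - by apply: ((BP n).2 m (u y').1) => //; rewrite -xE.
  - by move: xy2; rewrite x2 y2 uxy; case: (u y').2.
have [m mP] : exists m, forall p' q', pagree m (u x) p' -> pagree m (u y) q' ->
    ~ rel_of sym refl a p' q'.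
  apply: contrapT => /forallNP hm.
  have [|//|//] := @rel_of_closed sym refl a (u x) (u y).
  move=> m; apply: contrapT => hN; apply: (hm m) => p' q' xp yq r.
  by apply: hN; exists p', q'; split=> //; left.
have [k kP] := cont x m; have [l lP] := cont y m.
exists (maxn k l) => x' y' xx' yy'; apply: mP.
  by apply: kP; apply: agree_le xx'; rewrite leq_maxl.
by apply: lP; apply: agree_le yy'; rewrite leq_maxr.
Qed.

Definition half_code (e : bool) (y : nat -> nat) : nat -> nat := fun i => y (e + i.*2)%N.

(** The witness interleaves codes of preimages of the two copies of [x], exhibiting [fibers] as the
    projection of a closed relation. *)
Definition fiber_code (x : nat -> bool) (y : nat -> nat) : Prop :=
  forall e, exists p, u p = (x, e) /\ h p = half_code e y.

Lemma agree_half_code k e y y' : agree (k.*2) y y' ->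
  agree k (half_code e y) (half_code e y').
Proof. by move=> yy' i ik; apply: yy'; case: e; lia. Qed.

Lemma closed_fiber_code : closed_rel fiber_code.
Proof.
move=> x y app e.
have [|p hp] := ch.2 (half_code e y).
  move=> k; have [x' [y' [xy' _ yy']]] := app (k.*2); have [p [_ hp]] := xy' e.
  by exists p; rewrite hp; apply/agree_half_code/agree_sym.
exists p; split=> //.
have near m : pagree m (u p) (x, e).
  have [k kP] := coded_continuous p m.
  have [x' [y' [xy' xx' yy']]] := app (maxn (k.*2) m); have [p' [up' hp']] := xy' e.
  have := kP p'; rewrite hp hp' up' => -[].
    by apply: agree_half_code; apply: agree_le yy'; rewrite leq_maxl.
  move=> /= px' p2; split=> //; apply: agree_trans px' _.
  by apply: agree_sym; apply: agree_le xx'; rewrite leq_maxr.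
rewrite (surjective_pairing (u p)); have [_ /= ->] := near 0%N; congr pair.
by apply/funext => i; have [-> //] := near i.+1.
Qed.

Lemma fiber_codeE : [set x | exists y, fiber_code x y] = fibers.
Proof.
apply/seteqP; split=> x.
  move=> [y xy]; split; first by have [p [up _]] := xy false; exists p.
  by have [q [uq _]] := xy true; exists q.
move=> [[p up] [q uq]].
exists (fun i => if odd i then h q i./2 else h p i./2); case.
  exists q; split=> //; apply/funext => i.
  by rewrite /half_code /= odd_double uphalf_double.
exists p; split=> //; apply/funext => i.
by rewrite /half_code /= odd_double doubleK.
Qed.

(** The embedding returns with each [W z] the codes of preimages of its two copies. These codes
    depend continuously on [z], so the preimages give a continuous reduction. *)
Lemma not_small_fibers_reducible : ~ small fibers ->
  borel_reducible (rel_set sym refl a) F.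
Proof.
rewrite -fiber_codeE => /(analytic_embedding a closed_fiber_code).
move=> [W [Y [WY Yc Winj Wed]]].
have /ex_choice[v vP] : forall p : cantor2, exists x,
    u x = (W p.1, p.2) /\ h x = half_code p.2 (Y p.1).
  by move=> [z e]; exact: (WY z e).
exists v.
  apply: borel_map_open => U /ho hU; apply: open_borel.
  rewrite openE => p /hU[k kU]; apply/nbhs_cantor2; exists (k.*2) => q [pq1 pq2].
  apply: kU; have [_ ->] := vP p; have [_ ->] := vP q; rewrite pq2.
  exact/agree_half_code/Yc.
rewrite FE; apply/seteqP; split=> -[p q]; rewrite /rel_set /=.
  have [-> _] := vP p; have [-> _] := vP q.
  case=> [[p2 q2 ed]|[sy [q2 p2 ed]]|[rf ->]].
  - by apply: Or31; split=> //=; apply/Wed.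
  - by apply: Or32; split=> //; split=> //=; apply/Wed.
  - exact: Or33.
have [-> _] := vP p; have [-> _] := vP q.
case=> [[/= p2 q2 /Wed ed]|[sy [/= q2 p2 /Wed ed]]|[rf [/Winj p1 p2]]].
- exact: Or31.
- exact: Or32.
- by apply: Or33; split=> //; rewrite (surjective_pairing p) p1 p2 -surjective_pairing.
Qed.

End Minimality.

Lemma open_bit (i : nat) : open [set p : cantor2 | p.1 i].
Proof.
rewrite openE => p /= pi; apply/nbhs_cantor2; exists i.+1 => q [pq _] /=.
by rewrite -pq.
Qed.

Lemma open_snd : open [set p : cantor2 | p.2].
Proof.
by rewrite openE => p /= p2; apply/nbhs_cantor2; exists 0%N => q [_ pq2] /=; rewrite -pq2.
Qed.

Lemma rel_set_minimal (K : realType) sym refl a :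
  minimal_not_potentially_closed K (rel_set sym refl a).
Proof.
split; first exact: rel_set_not_potentially_closed.
move=> X F pX _ nF [u ub FE].
have [h0 [ch0 h0o]] := polish_code pX.
(* The code is refined to make every coordinate of [u], and its copy under [None], continuous. *)
have [|h [ch h0h hu]] := @codable_family _ h0 (option nat)
    (fun o => if o is Some i then [set x | (u x).1 i] else [set x | (u x).2]) ch0.
  case=> [i|]; apply: (@borel_codable X h0 _ ch0 h0o); first exact: (ub _ (open_borel (@open_bit i))).
  exact: (ub _ (open_borel open_snd)).
have ho (U : set X) : open U -> open_for h U by move/h0o; exact: refines_open_for.
apply: (not_small_fibers_reducible FE ch ho (fun i => hu (Some i)) (hu None)).
apply: contra_not nF.
exact: (small_fibers_potentially_closed K FE ch ho (fun i => hu (Some i)) (hu None)).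
Qed.

Lemma rel_set_antichain sym refl (a b : cantor_space) :
  borel_reducible (rel_set sym refl a) (rel_set sym refl b) -> a = b.
Proof.
move=> [u ub uE].
pose B (o : bool * option nat) : set (nat -> bool) :=
  if o.2 is Some i then [set x | (u (x, o.1)).1 i] else [set x | (u (x, o.1)).2].
have [|G [Gne Gf Gc]] := @bor_generic _ B.
  move=> [e [i|]]; rewrite /B /=.
    exact: (@borel_slice [set p | (u p).1 i] _ (ub _ (open_borel (@open_bit i)))).
  exact: (@borel_slice [set p | (u p).2] _ (ub _ (open_borel open_snd))).
have [x [_ Gx]] := Gne [::].
apply: (@reduction_eq sym refl a b u _ G Gf _ x Gx).
  move=> p q; have E : rel_of sym refl a p q = rel_of sym refl b (u p) (u q).
    exact: (congr1 (fun A : set (cantor2 * cantor2) => A (p, q)) uE).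
  by rewrite E.
move=> {x Gx} x k Gx.
have /ex_choice[f fP] : forall o, exists k, forall y, G y -> agree k x y ->
    (B o x <-> B o y) by move=> o; exact: Gc.
have [l lP] := ex_bound (fun i => maxn (f (false, Some i)) (f (true, Some i))) k.
pose m := maxn l (maxn (f (false, None)) (f (true, None))).
have fm e : (f (e, None) <= m)%N by rewrite /m !leq_max; case: e; rewrite leqnn ?orbT.
have fm' e i : (i < k)%N -> (f (e, Some i) <= m)%N.
  move=> /lP/ltnW; rewrite geq_max => /andP[f0 f1].
  by rewrite (@leq_trans l) ?leq_maxl//; case: e.
exists m => y Gy xy e; split.
  by move=> i /(fm' e) fi; apply/idP/idP => h; apply/(fP (e, Some i) y Gy (agree_le fi xy)).
by apply/idP/idP => h; apply/(fP (e, None) y Gy (agree_le (fm e) xy)).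
Qed.

Theorem theorem6 (K : realType) (C : relation_class) :
  exists R : cantor_space -> set (cantor2 * cantor2),
    [/\ forall a : cantor_space, in_class C (R a),
        forall a : cantor_space, difference_of_open (R a),
        perfect_antichain (@borel_reducible cantor2 cantor2) R
      & forall a : cantor_space, minimal_not_potentially_closed K (R a)].
Proof.
pose sym := if C is Graph then true else false.
pose refl := if C is (QuasiOrder | PartialOrder) then true else false.
exists (rel_set sym refl); split.
- have irr s a : irreflexive_set (rel_set s false a).
    by move=> x [[-> //]|[_ [-> //]]|[//]].
  have anti r a : antisymmetric_set (rel_set false r a).
    move=> x y [[/= x2 y2 _]|[//]|[_ //]] [[/= y2' _ _]|[//]|[_ /= ->//]].
    by rewrite y2 in y2'.
  have trans r a : transitive_set (rel_set false r a).
    move=> x y z [[/= x2 y2 xy]|[//]|[_ /= -> //]] [[/= y2' _ _]|[//]|[rf /= <-]].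
      by rewrite y2 in y2'.
    exact: Or31.
  have rf s a : reflexive_set (rel_set s true a) by move=> x; exact: Or33.
  case: C @sym @refl => sym refl a.
  + exact: irr.
  + split; first exact: irr.
    by move=> x y [?|[_ ?]|[]//]; [apply: Or32|apply: Or31].
  + by split; [exact: irr|exact: anti].
  + by split; [exact: rf|exact: trans].
  + by split; [exact: irr|exact: trans].
  + by split; [exact: rf|exact: anti|exact: trans].
  + by split; [exact: irr|exact: anti|exact: trans].
- move=> a; exists (~` limit_set sym), (~` (rel_set sym refl a `|` limit_set sym)).
  by split; [exact: open_setC_limit|exact: open_setC_rel_limit|exact: rel_setE].
- split.
  + by move=> a; exact: borel_rel_set.
  + by move=> a b ab /rel_set_antichain.
  + by exists (rel_code sym refl); [exact: rel_code_continuous|exact: rel_codeP].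
- by move=> a; exact: rel_set_minimal.
Qed.
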